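(* Let $V$ be a vertex algebra, let $g$ be an automorphism of $V$ of finite order $T$, and let $n\in(1/T)\mathbb{N}$. Then the product $\bullet_{g,n}$ induces the structure of an associative algebra on the quotient space $\tilde{A}_{g,n}(V)=V/\tilde{O}_{g,n}(V)$, with identity element $\mathbf{1}+\tilde{O}_{g,n}(V)$.
   Context: All vector spaces are over $\mathbb{C}$, and $\mathbb{N}=\{0,1,2,\dots\}$. A vertex algebra is a vector space $V$ with a linear map $Y(\cdot,x):V\to(\operatorname{End}V)[[x,x^{-1}]]$, $v\mapsto Y(v,x)=\sum_{n\in\mathbb{Z}}v_nx^{-n-1}$, and a vector $\mathbf{1}\in V$ (the vacuum) such that for all $u,v\in V$: $Y(\mathbf{1},z)=\operatorname{id}_V$ and $u_n\mathbf{1}=\delta_{n,-1}u$ for $n\ge -1$; $u_nv=0$ for $n$ sufficiently large; and the Jacobi identity $$z_0^{-1}\delta\left(\tfrac{z_1-z_2}{z_0}\right)Y(u,z_1)Y(v,z_2)-z_0^{-1}\delta\left(\tfrac{z_2-z_1}{-z_0}\right)Y(v,z_2)Y(u,z_1)=z_2^{-1}\delta\left(\tfrac{z_1-z_0}{z_2}\right)Y(Y(u,z_0)v,z_2)$$ holds, where $\delta(z)=\sum_{k\in\mathbb{Z}}z^k$ and binomials are expanded in nonnegative powers of the second variable. The operator $\mathcal{D}$ on $V$ is $\mathcal{D}v=v_{-2}\mathbf{1}$. An automorphism $g$ of $V$ is a linear isomorphism with $g(\mathbf{1})=\mathbf{1}$ and $g(Y(u,z)v)=Y(g(u),z)g(v)$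 for all $u,v\in V$. For $g$ of finite order $T$, $V=\bigoplus_{r=0}^{T-1}V^r$ with $V^r=\{v\in V\mid gv=e^{-2\pi\sqrt{-1}r/T}v\}$; in $V^r$ always $r\in\{0,\dots,T-1\}$. For $k,l\in\{0,\dots,T-1\}$ put $\delta_k(l)=1$ if $k\ge l$ and $\delta_k(l)=0$ if $k<l$; put $\delta_k(T)=0$. For $n\in(1/T)\mathbb{N}$ write $n=\lfloor n\rfloor+\bar n/T$ with $\bar n\in\{0,\dots,T-1\}$. $\operatorname{Res}_x$ is the coefficient of $x^{-1}$, with all expressions expanded as Laurent series in $x$. For $u\in V^r$, $v\in V$ define (extending linearly in $u$) $$u\diamond_{g,n}v=\operatorname{Res}_x\frac{e^{x(\delta_{\bar n}(r)+\lfloor n\rfloor+r/T)}}{(e^x-1)^{2\lfloor n\rfloor+\delta_{\bar n}(r)+\delta_{\bar n}(T-r)+1}}Y(u,x)v,$$ $$u\bullet_{g,n}v=\sum_{m=0}^{\lfloor n\rfloor}(-1)^m\binom{m+\lfloor n\rfloor}{\lfloor n\rfloor}\operatorname{Res}_x\frac{e^{x(\lfloor n\rfloor+1)}}{(e^x-1)^{\lfloor n\rfloor+m+1}}Y(u,x)v\quad\text{if }r=0,$$ and $u\bullet_{g,n}v=0$ if $r>0$. Let $\tilde{O}_{g,n}(V)$ be the linear span of all $u\diamond_{g,n}v$ and $\mathcal{D}u$ for $u,v\in V$, and $\tilde{A}_{g,n}(V)=V/\tilde{O}_{g,n}(V)$. *)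

(* Defs.v *)
From HB Require Import structures.
From mathcomp Require Import all_boot all_order all_algebra.
From mathcomp Require Import zify ring lra.
From mathcomp Require Import generic_quotient ring_quotient complex.
From mathcomp Require Import all_classical all_reals.
From mathcomp Require Import topology normedtype trigo.

Set Implicit Arguments.
Unset Strict Implicit.
Unset Printing Implicit Defensive.

Import Order.TTheory GRing.Theory Num.Theory.
Local Open Scope classical_set_scope.
Local Open Scope ring_scope.
Local Open Scope complex_scope.
Local Open Scope quotient_scope.

Section FormalSeries.
Variable K : numFieldType.
Implicit Types (f h : nat -> K) (a : K).

(* A power series is its coefficient sequence. *)
Definition fps_mul f h : nat -> K := fun k => \sum_(i < k.+1) f i * h (k - i)%N.
Definition fps_one : nat -> K := fun k => (k == 0%N)%:R.
Definition fps_pow f m : nat -> K := iter m (fps_mul f) fps_one.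
Definition fps_exp a : nat -> K := fun k => a ^+ k / k`!%:R.

(* The geometric series sum_i (1 - f)^i, which inverts f when f 0 = 1: see
   fps_mulV. The terms of index i > k do not contribute in degree k. *)
Definition fps_inv f : nat -> K :=
  fun k => \sum_(i < k.+1) fps_pow (fun j => fps_one j - f j) i k.

(* (e^x - 1) / x *)
Definition fps_expm1X : nat -> K := fun k => (k.+1)`!%:R^-1.

(* Doubly infinite series are functions on int. The Laurent expansion at x = 0
   of e^(a x) / (e^x - 1)^m = x^(-m) * e^(a x) * ((e^x - 1) / x)^(-m). *)
Definition exp_kernel a (m : nat) : int -> K := fun p =>
  if p + m%:Z is Posz j
  then fps_mul (fps_exp a) (fps_pow (fps_inv fps_expm1X) m) j else 0.

Definition gbinom (k : int) (i : nat) : K :=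
  (\prod_(j < i) (k%:~R - j%:R)) / i`!%:R.

(* The coefficient of a^(k - i) b^i in (a - b)^k, expanded in nonnegative
   powers of b. *)
Definition subX_coef (k : int) (i : nat) : K := (-1) ^+ i * gbinom k i.

Variable V : lmodType K.

Definition laurent_mul (F : int -> K) (G : int -> V) : int -> V :=
  fun m => \sum_(p \in [set: int]) F p *: G (m - p).

Definition residue (G : int -> V) : V := G (-1).

End FormalSeries.

Section FormalSeriesTheory.
Variable K : numFieldType.
Implicit Types (f h : nat -> K).

Lemma fps_pow_lt f i k : f 0%N = 0 -> (k < i)%N -> fps_pow f i k = 0.
Proof.
move=> f0; elim: i k => // i IH k ki; rewrite /fps_pow iterS -/(fps_pow f i).
rewrite /fps_mul big1 // => -[[|j] ji] _ /=; first by rewrite f0 mul0r.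
by rewrite IH ?mulr0//; lia.
Qed.

Lemma fps_mulV f : f 0%N = 1 -> fps_mul f (fps_inv f) =1 fps_one K.
Proof.
move=> f1 k; pose e := fun j => fps_one K j - f j.
have e0 : e 0%N = 0 by rewrite /e /fps_one eqxx f1 subrr.
have invE j : (j <= k)%N -> fps_inv f j = \sum_(0 <= i < k.+1) fps_pow e i j.
  move=> jk; rewrite (@big_cat_nat _ _ _ j.+1 0 k.+1)//= [X in _ = _ + X]big_nat_cond.
  rewrite [X in _ = _ + X]big1 ?addr0 ?big_mkord// => i /andP[/andP[ji _] _].
  exact: fps_pow_lt.
rewrite /fps_mul.
under eq_bigr => i _ do rewrite invE ?leq_subr// mulr_sumr.
rewrite exchange_big/=.
have step i : \sum_(j < k.+1) f j * fps_pow e i (k - j)%N =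
    fps_pow e i k - fps_pow e i.+1 k.
  rewrite [fps_pow e i.+1]iterS -/(fps_pow e i) /fps_mul.
  have -> : fps_pow e i k =
      \sum_(j < k.+1) fps_one K j * fps_pow e i (k - j)%N.
    rewrite big_ord_recl/= /fps_one mul1r subn0 big1 ?addr0// => j _.
    by rewrite /= mul0r.
  rewrite -sumrB; apply: eq_bigr => j _.
  by rewrite -mulrBl /e opprB addrCA subrr addr0.
under eq_bigr => i _ do rewrite step.
rewrite (@telescope_sumr_eq _ _ _ (fun i => - fps_pow e i k))//; last first.
  by move=> i _; rewrite opprK addrC.
by rewrite (fps_pow_lt e0 (ltnSn k)) oppr0 opprK add0r.
Qed.

End FormalSeriesTheory.

Record vertexAlgebra (K : numFieldType) (V : lmodType K) := VertexAlgebra {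
  (* vmode u n is the endomorphism u_n *)
  vmode : V -> int -> V -> V;
  vacuum : V;
  vmode_linearl : forall n v, linear (fun u => vmode u n v);
  vmode_linearr : forall u n, linear (vmode u n);
  vacuum_mode : forall n v, vmode vacuum n v = if n == -1 then v else 0;
  mode_vacuum : forall u (n : int), -1 <= n ->
    vmode u n vacuum = if n == -1 then u else 0;
  vmode_truncation : forall u v,
    exists N : int, forall n : int, N <= n -> vmode u n v = 0;
  (* The Jacobi identity applied to w, in the coefficient of
     z0^(-l-1) z1^(-m-1) z2^(-n-1). With (a - b)^k = sum_i subX_coef k i
     a^(k-i) b^i, the three delta functions are
       sum_k z0^(-k-1) (z1 - z2)^k, sum_k (-1)^k z0^(-k-1) (z2 - z1)^k and
       sum_k z2^(-k-1) (z1 - z0)^k,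
     and only k = l contributes to the first two, k = i - m - 1 to the last.
     The sums are finitely supported by vmode_truncation. *)
  vertex_jacobi : forall u v w (l m n : int),
    \sum_(i \in [set: nat]) subX_coef K l i *:
        vmode u (m + l - i%:Z) (vmode v (n + i%:Z) w)
    - (-1) ^ l *: \sum_(i \in [set: nat]) subX_coef K l i *:
        vmode v (n + l - i%:Z) (vmode u (m + i%:Z) w)
    = \sum_(i \in [set: nat]) subX_coef K (i%:Z - m - 1) i *:
        vmode (vmode u (l + i%:Z) v) (m + n - i%:Z) w
}.

Section VertexAlgebra.
Variables (K : numFieldType) (V : lmodType K) (A : vertexAlgebra V).

Definition vseries (u v : V) : int -> V := fun m => vmode A u (- m - 1) v.

Definition translation (v : V) : V := vmode A v (-2) (vacuum A).

Definition vertex_automorphism (g : {linear V -> V}) : Prop :=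
  [/\ bijective g, g (vacuum A) = vacuum A &
      forall u n v, g (vmode A u n v) = vmode A (g u) n (g v)].

Definition has_order (g : V -> V) (T : nat) : Prop :=
  [/\ (0 < T)%N, forall v, iter T g v = v &
      forall k, (0 < k < T)%N -> ~ forall v, iter k g v = v].

End VertexAlgebra.

Section LinearSpan.
Variables (K : numFieldType) (V : lmodType K) (S : set V).

Definition lin_span : set V := [set v | exists (m : nat) (c : 'I_m -> K)
  (s : 'I_m -> V), (forall i, S (s i)) /\ v = \sum_(i < m) c i *: s i].

Definition lin_spanb : {pred V} := fun v => `[< lin_span v >].

Lemma lin_spanb_submod : submod_closed lin_spanb.
Proof.
split; first by apply/asboolP; exists 0%N, (fun=> 0), (fun=> 0); split;
  [case | rewrite big_ord0].
move=> a _ _ /asboolP[m [c [s [Ss ->]]]] /asboolP[p [d [t [St ->]]]].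
apply/asboolP; exists (m + p)%N.
exists (fun i : 'I_(m + p) =>
  match fintype.split i with inl j => a * c j | inr j => d j end).
exists (fun i : 'I_(m + p) =>
  match fintype.split i with inl j => s j | inr j => t j end).
split; first by move=> i; case: fintype.split.
rewrite big_split_ord/= scaler_sumr; congr (_ + _); apply: eq_bigr => i _.
  by rewrite (unsplitK (inl i)) scalerA.
by rewrite (unsplitK (inr i)).
Qed.

HB.instance Definition _ :=
  GRing.isSubmodClosed.Build K V lin_spanb lin_spanb_submod.

(* V / lin_span S *)
Definition span_quot : Type := Quotient.quot lin_spanb.
HB.instance Definition _ := GRing.Zmodule.on span_quot.

Definition span_pi (v : V) : span_quot := \pi_(Quotient.quot lin_spanb) v.
Definition span_scale (a : K) (x : span_quot) : span_quot :=
  span_pi (a *: repr (x : Quotient.quot lin_spanb)).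

Lemma span_pi_eq u v : span_pi u = span_pi v <-> lin_span (u - v).
Proof.
rewrite /span_pi; split => [/eqP|uv]; last apply/eqP.
  by rewrite -Quotient.idealrBE => /asboolP.
by rewrite -Quotient.idealrBE; apply/asboolP.
Qed.

Lemma span_pi_surj (x : span_quot) : exists v, span_pi v = x.
Proof. by exists (repr (x : Quotient.quot lin_spanb)); exact: reprK. Qed.

Lemma span_piD u v : span_pi (u + v) = span_pi u + span_pi v.
Proof. by rewrite /span_pi; exact: (raddfD (\pi_(Quotient.quot lin_spanb))). Qed.

Lemma span_scale_pi a u : span_scale a (span_pi u) = span_pi (a *: u).
Proof.
apply/span_pi_eq; rewrite -scalerBr; apply/asboolP.
rewrite -[asbool _]/(_ \in lin_spanb) rpredZ//.
by rewrite Quotient.idealrBE reprK.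
Qed.

Fact span_scaleA a b x : span_scale a (span_scale b x) = span_scale (a * b) x.
Proof. by have [v <-] := span_pi_surj x; rewrite !span_scale_pi scalerA. Qed.
Fact span_scale1 : left_id 1 span_scale.
Proof. by move=> x; have [v <-] := span_pi_surj x; rewrite span_scale_pi scale1r. Qed.
Fact span_scaleDr : right_distributive span_scale +%R.
Proof.
move=> a x y; have [u <-] := span_pi_surj x; have [v <-] := span_pi_surj y.
by rewrite -span_piD !span_scale_pi scalerDr span_piD.
Qed.
Fact span_scaleDl x : {morph span_scale^~ x : a b / a + b}.
Proof.
by move=> a b; have [v <-] := span_pi_surj x; rewrite !span_scale_pi scalerDl span_piD.
Qed.

HB.instance Definition _ := GRing.Zmodule_isLmodule.Build K span_quot
  span_scaleA span_scale1 span_scaleDr span_scaleDl.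

Lemma span_pi_linear : linear span_pi.
Proof. by move=> a u v; rewrite span_piD -span_scale_pi. Qed.

End LinearSpan.

(* MathComp's algType carries its product as a canonical structure and, through
   nzRingType, excludes the zero algebra, which may occur as a quotient. *)
Definition unital_assoc_algebra (K : numFieldType) (Q : lmodType K)
    (mul : Q -> Q -> Q) (one : Q) : Prop :=
  [/\ forall y, linear (mul^~ y), forall x, linear (mul x), associative mul,
      left_id one mul & right_id one mul].

Section TwistedProducts.
Variables (R : realType) (V : lmodType R[i]) (A : vertexAlgebra V).
Variables (g : {linear V -> V}) (T : nat) (n : rat).

(* e^(i t) *)
Definition cexpi (t : R) : R[i] := (cos t +i* sin t)%C.

Definition eigspace (r : nat) : set V :=
  [set v | g v = cexpi (- (2 * pi * r%:R / T%:R)) *: v].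

(* The component in eigspace r, r < T, of v, when g has order T: see
   eigproj_in, eigproj_sum and eigproj_unique. *)
Definition eigproj (r : nat) (v : V) : V :=
  T%:R^-1 *: \sum_(k < T) cexpi (2 * pi * (r * k)%:R / T%:R) *: iter k g v.

Definition extend_linearly (f : nat -> V -> V -> V) (u v : V) : V :=
  \sum_(r < T) f r (eigproj r u) v.

(* For 0 <= n the integer part of n is truncn n, and n is
   nfloor + nbar / T when n is a multiple of 1/T. *)
Definition nfloor : nat := Num.truncn n.
Definition nbar : nat := Num.truncn ((n - nfloor%:R) * T%:R).

(* In particular tdelta k T = 0 for k < T. *)
Definition tdelta (k l : nat) : nat := (l <= k)%N.

Definition diamond_hom (r : nat) (u v : V) : V :=
  residue (laurent_mul
    (exp_kernel ((tdelta nbar r + nfloor)%:R + r%:R / T%:R : R[i])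
       (2 * nfloor + tdelta nbar r + tdelta nbar (T - r) + 1))
    (vseries A u v)).

Definition bullet_hom (r : nat) (u v : V) : V :=
  if r == 0%N then
    \sum_(m < nfloor.+1) ((-1) ^+ m * 'C(m + nfloor, nfloor)%:R : R[i]) *:
      residue (laurent_mul
        (exp_kernel (nfloor.+1%:R : R[i]) (nfloor + m + 1)) (vseries A u v))
  else 0.

Definition diamond : V -> V -> V := extend_linearly diamond_hom.
Definition bullet : V -> V -> V := extend_linearly bullet_hom.

Definition O_gens : set V :=
  [set w | (exists u v, w = diamond u v) \/ (exists u, w = translation A u)].

Definition Otilde : set V := lin_span O_gens.

Definition Atilde : lmodType R[i] := span_quot O_gens.

Definition Atilde_pi : V -> Atilde := @span_pi _ V O_gens.

End TwistedProducts.

Section TwistedProductsTheory.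
Variables (R : realType) (V : lmodType R[i]).
Variables (g : {linear V -> V}) (T : nat).
Hypothesis gT : has_order g T.

Let T0 : (0 < T)%N. Proof. by case: gT. Qed.
Let TR : T%:R != 0 :> R. Proof. by rewrite pnatr_eq0 -lt0n. Qed.

Lemma cexpiD (s t : R) : cexpi (s + t) = cexpi s * cexpi t.
Proof.
rewrite /cexpi cosD sinD; apply/eqP; rewrite eq_complex/= eqxx/=.
by rewrite addrC [cos s * _]mulrC [sin s * cos t]mulrC [cos t * sin s]mulrC.
Qed.

Lemma cexpi0 : cexpi (0 : R) = 1.
Proof. by rewrite /cexpi cos0 sin0. Qed.

Lemma cexpi_2pi (k : nat) : cexpi (2 * pi * k%:R : R) = 1.
Proof.
elim: k => [|k IH]; first by rewrite mulr0 cexpi0.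
rewrite -[k.+1%:R]natr1 mulrDr cexpiD IH mul1r mulr1 /cexpi mulrC mulr_natr.
by rewrite cos2pi sin2pi.
Qed.

Lemma cexpiX (t : R) (k : nat) : cexpi t ^+ k = cexpi (t * k%:R).
Proof.
elim: k => [|k IH]; first by rewrite mulr0 cexpi0.
by rewrite exprSr IH -[k.+1%:R]natr1 mulrDr mulr1 cexpiD.
Qed.

Lemma cexpi_neq1 (s : nat) :
  (0 < s < T)%N -> cexpi (2 * pi * s%:R / T%:R : R) != 1.
Proof.
move=> /andP[s0 sT]; pose x : R := pi * s%:R / T%:R.
have T0R : 0 < T%:R :> R by rewrite ltr0n.
have xI : 0 < x < pi.
  apply/andP; split; first by rewrite divr_gt0 ?mulr_gt0 ?pi_gt0 ?ltr0n.
  by rewrite ltr_pdivrMr// ltr_pM2l ?pi_gt0// ltr_nat.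
have -> : 2 * pi * s%:R / T%:R = x *+ 2 :> R by rewrite /x mulr2n; field.
rewrite eq_complex/= negb_and cos_mulr2n.
have sx : sin x != 0 by rewrite gt_eqF// sin_gt0_pi.
apply/orP; left; apply/eqP => h; have := cos2Dsin2 x.
have -> : cos x ^+ 2 = 1 by lra.
move=> h2; have /eqP : sin x ^+ 2 = 0 by lra.
by rewrite expf_eq0/= (negPf sx).
Qed.

Lemma cexpi_sum (r s : nat) : (r < T)%N -> (s < T)%N ->
  \sum_(k < T) cexpi (2 * pi * (r * k)%:R / T%:R)
               * cexpi (- (2 * pi * s%:R / T%:R)) ^+ k
  = (T * (r == s))%:R :> R[i].
Proof.
move=> rT sT.
pose z : R[i] := cexpi (2 * pi * r%:R / T%:R) * cexpi (- (2 * pi * s%:R / T%:R)).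
have zE (k : nat) : cexpi (2 * pi * (r * k)%:R / T%:R)
               * cexpi (- (2 * pi * s%:R / T%:R)) ^+ k = z ^+ k :> R[i].
  rewrite /z exprMn !cexpiX; congr (cexpi _ * _).
  by rewrite natrM; field.
under eq_bigr => k _ do rewrite zE.
have expN (t : R) : cexpi (- t) * cexpi t = 1 by rewrite -cexpiD addNr cexpi0.
have [rs|rs] := eqVneq r s.
  have -> : z = 1 by rewrite /z rs mulrC expN.
  under eq_bigr => k _ do rewrite expr1n.
  by rewrite sumr_const card_ord muln1.
have zT : z ^+ T = 1.
  rewrite /z exprMn !cexpiX mulNr !divfK// cexpi_2pi mul1r.
  by rewrite -[LHS]mulr1 -{1}(cexpi_2pi s) expN.
have z1 : z != 1.
  have [rs'|rs'] := ltnP r s.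
    apply: contra (cexpi_neq1 (s := s - r) _); last lia.
    move=> /eqP z1; apply/eqP; rewrite -[LHS]mulr1 -[X in _ * X = _]z1 /z mulrA -cexpiD.
    by rewrite -(expN (2 * pi * s%:R / T%:R)) [RHS]mulrC; congr (cexpi _ * _);
       rewrite natrB 1?ltnW//; field.
  apply: contra (cexpi_neq1 (s := r - s) _); last lia.
  move=> /eqP <-; apply/eqP; rewrite /z -cexpiD; congr cexpi.
  by rewrite natrB//; field.
apply/eqP; rewrite muln0; have /eqP := subrX1 z T.
by rewrite zT subrr eq_sym mulf_eq0 subr_eq0 (negPf z1).
Qed.

Lemma eigspace_iter r v k : eigspace g T r v ->
  iter k g v = cexpi (- (2 * pi * r%:R / T%:R)) ^+ k *: v.
Proof.
move=> gv; elim: k => [|k IH]; first by rewrite scale1r.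
by rewrite iterS IH linearZ/= gv scalerA -exprSr.
Qed.

Lemma eigproj_unique (w : 'I_T -> V) (r : 'I_T) :
  (forall s : 'I_T, eigspace g T s (w s)) ->
  eigproj g T r (\sum_(s < T) w s) = w r.
Proof.
move=> hw; rewrite /eigproj.
have itS k : iter k g (\sum_(s < T) w s) = \sum_(s < T) iter k g (w s).
  by elim: k => //= k ->; rewrite linear_sum.
under eq_bigr => k _.
  rewrite itS scaler_sumr.
  under eq_bigr => s _ do rewrite (eigspace_iter _ (hw s)) scalerA.
  over.
rewrite exchange_big/=.
under eq_bigr => s _ do rewrite -scaler_suml cexpi_sum//.
rewrite (bigD1 r)//= eqxx muln1 big1 ?addr0 => [|s sr].
  by rewrite scalerA mulVf ?scale1r// pnatr_eq0 -lt0n.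
by rewrite -val_eqE eq_sym in sr; rewrite (negPf sr) muln0 scale0r.
Qed.

Lemma eigproj_in r v : eigspace g T r (eigproj g T r v).
Proof.
rewrite /eigspace/= /eigproj linearZ/= linear_sum/= scalerA [X in _ = X *: _]mulrC -scalerA.
congr (_ *: _).
have step k : g (cexpi (2 * pi * (r * k)%:R / T%:R) *: iter k g v) =
    cexpi (- (2 * pi * r%:R / T%:R)) *:
      (cexpi (2 * pi * (r * k.+1)%:R / T%:R) *: iter k.+1 g v).
  rewrite linearZ/= scalerA -cexpiD; congr (cexpi _ *: _).
  by rewrite mulnS natrD; field.
under eq_bigr => k _ do rewrite step.
rewrite -!scaler_sumr; congr (_ *: _).
pose F k := cexpi (2 * pi * (r * k)%:R / T%:R : R) *: iter k g v.
rewrite -(big_mkord xpredT (fun k => F k.+1)) -(big_mkord xpredT F).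
have FT : F T = F 0%N.
  rewrite /F muln0 mulr0 mul0r cexpi0 natrM mulrA mulfK// cexpi_2pi.
  by have [_ -> _] := gT.
case: (T) T0 FT => // m _ FT.
by rewrite big_nat_recr//= FT [RHS]big_nat_recl// addrC.
Qed.

Lemma eigproj_sum v : \sum_(r < T) eigproj g T r v = v.
Proof.
rewrite /eigproj -scaler_sumr exchange_big/=.
under eq_bigr => k _ do rewrite -scaler_suml.
have sumE (k : 'I_T) : \sum_(r < T) cexpi (2 * pi * (r * k)%:R / T%:R) =
    (T * (k == 0 :> nat))%:R :> R[i].
  rewrite -(cexpi_sum (ltn_ord k) T0); apply: eq_bigr => r _.
  by rewrite mulr0 mul0r oppr0 cexpi0 expr1n mulr1 mulnC.
under eq_bigr => k _ do rewrite sumE.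
rewrite (bigD1 (Ordinal T0))//= muln1 big1 ?addr0 => [|k k0].
  by rewrite scalerA mulVf ?scale1r// pnatr_eq0 -lt0n.
by rewrite -val_eqE/= in k0; rewrite (negPf k0) muln0 scale0r.
Qed.

Lemma nbarP (n : rat) : (exists N : nat, n = N%:R / T%:R) ->
  (nbar T n < T)%N /\ n = (nfloor n)%:R + (nbar T n)%:R / T%:R.
Proof.
case=> N nE.
have T0Q : 0 < T%:R :> rat by rewrite ltr0n.
have TQ : T%:R != 0 :> rat by rewrite gt_eqF.
have nE' : n = (N %/ T)%:R + (N %% T)%:R / T%:R.
  by rewrite nE {1}(divn_eq N T) natrD natrM mulrDl mulfK.
have mT : (N %% T < T)%N by rewrite ltn_pmod.
have fE : nfloor n = (N %/ T)%N.
  apply: truncn_def; rewrite nE' lerDl divr_ge0//= -natr1 ltrD2l.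
  by rewrite ltr_pdivrMr// mul1r ltr_nat.
have bE : nbar T n = (N %% T)%N.
  by rewrite /nbar fE {1}nE' addrAC subrr add0r divfK// natrK.
by rewrite fE bE.
Qed.

End TwistedProductsTheory.

(* Main.v *)
Require Import Defs.
From HB Require Import structures.
From mathcomp Require Import all_boot all_order all_algebra complex reals.
From mathcomp Require Import zify ring.
From mathcomp Require Import boolp classical_sets functions fsbigop.
From mathcomp Require Import trigo.

Set Implicit Arguments.
Unset Strict Implicit.
Unset Printing Implicit Defensive.

Import Order.TTheory GRing.Theory Num.Theory.
Local Open Scope ring_scope.
Local Open Scope complex_scope.

(** Both products have the form Res_x F(x) Y(u,x)v for a Laurent series F, so
    the proof is about series F. Put z = e^x and y = 1/(e^x - 1), so that
    e^x y = 1 + y, and regard the series e^(a x) y^m p(y), p a polynomial, as z^a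
    times a rational function of z whose only pole is z = 1. The spaces
    [kernel a m] of all these series, with a and m fixed, collect the functions
    that vanish to prescribed orders at z = 0 and z = oo. They are stable under
    d/dx, since y' = - y - y^2; the substitution x -> - x, that is z -> 1/z, maps
    [kernel a m] to [kernel (m - a) m]; and products add the indices.

    The subspace divided out contains all D u, and Res F'(x) Y(u,x)v is
    - Res F(x) Y(D u,x)v. Hence integration by parts raises the order of the
    pole, and Res F(x) Y(u,x)v is divided out for every u in V^r and every F in
    the whole space [kernel a_r m_r] of the kernel of u <> v ([kernel_O]). The
    numbers a_r and m_r are such that x -> - x exchanges the spaces of r and
    T - r ([dual_index]).

    For r = 0 the kernel P of the product is a function of z that vanishes to
    order l + 1 at z = 0, where l is the integral part of n, and equals 1 up to
    order l + 1 at z = oo. Therefore P' and P(- x) P(x) lie in [kernel a_0 m_0]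
    ([lderiv_bullet_kernel], [bullet_kernel_negx]), while multiplication by P
    preserves each [kernel a m].

    Write u_F v for Res F(x) Y(u,x)v. The Jacobi identity gives ([kmode_assoc]),
    for all Laurent series F and G,
      (u_F v)_G w = u_F (v_G w) + sum_(i > 0) u_(F^(i)) y_i
                    + sum_(i >= 0) v_(F^(i)(- x) G) z_i
    with some vectors y_i and z_i. For F = G = P and u, v in V^0 both sums are
    divided out: this is associativity. For F the kernel of u <> v and G = P all
    terms are, so that the subspace is stable under multiplication from the
    right; the commutator formula [kmode_comm] does the same from the left. The
    vacuum is an identity because P has residue 1, and because every V^s with
    0 < s < T is divided out: u <> 1 is, up to some D w, the multiple of u by a
    residue, which is a binomial coefficient with a non-integral upper index and
    so does not vanish ([eig_O]). *)

(** * Finitely supported sums *)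

Lemma fsbig_box (W : nmodType) (M : int) (J : nat) (f : int -> W) :
  (forall p, p < M -> f p = 0) -> (forall p, M + J%:Z <= p -> f p = 0) ->
  \sum_(p \in [set: int]) f p = \sum_(j < J) f (M + j%:Z).
Proof.
move=> lo hi.
rewrite (fsbigE [seq M + j%:Z | j <- iota 0 J])//=; first last.
- move=> p _ pN; have [pM|Mp] := ltP p M; first exact: lo.
  have [|pJ] := leP (M + J%:Z) p; first exact: hi.
  case/negP: pN; apply/mapP; exists `|p - M|%N; last lia.
  by rewrite mem_iota; lia.
- by rewrite map_inj_uniq ?iota_uniq// => i j; lia.
rewrite big_map (eq_bigl xpredT); last by move=> ?; rewrite in_setT.
by rewrite -[X in iota 0 X]subn0 -/(index_iota 0 J) big_mkord.
Qed.

Lemma fsbig_nat_box (W : nmodType) (J : nat) (f : nat -> W) :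
  (forall p, (J <= p)%N -> f p = 0) ->
  \sum_(p \in [set: nat]) f p = \sum_(j < J) f j.
Proof.
move=> hi.
rewrite (fsbigE (iota 0 J))//= ?iota_uniq//; last first.
  by move=> p _ pN; apply: hi; rewrite mem_iota in pN; lia.
rewrite (eq_bigl xpredT); last by move=> ?; rewrite in_setT.
by rewrite -[X in iota 0 X]subn0 -/(index_iota 0 J) big_mkord.
Qed.

(** * The algebra of formal Laurent series *)

Section Laurent.
Variable K : numFieldType.

Definition bounded_below (F : int -> K^o) : bool :=
  `[< exists M : int, forall p, p < M -> F p = 0 >].

Lemma bounded_below_submod : submod_closed bounded_below.
Proof.
split; first by apply/asboolP; exists 0.
move=> a F G /asboolP[M FM] /asboolP[N GN]; apply/asboolP.
exists (Num.min M N) => p; rewrite lt_min => /andP[pM pN].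
by rewrite addrfctE scalrfctE FM ?GN// scaler0 addr0.
Qed.

HB.instance Definition _ :=
  GRing.isSubmodClosed.Build K (int -> K^o) bounded_below bounded_below_submod.

(** Laurent series in one variable with finitely many negative exponents, as a
    subtype of the doubly infinite series to which [laurent_mul] applies. *)
Record laurent := Laurent {
  lcoef :> int -> K^o;
  _ : lcoef \in bounded_below }.
HB.instance Definition _ := [isSub for lcoef].
HB.instance Definition _ := [Choice of laurent by <:].
HB.instance Definition _ := [SubChoice_isSubLmodule of laurent by <:].

Implicit Types (F G H : laurent) (f h : nat -> K) (M : int).

Lemma laurentP F G : (forall p, F p = G p) -> F = G.
Proof. by move=> FG; apply/val_inj/funext. Qed.

Lemma lcoefD F G p : (F + G) p = F p + G p. Proof. by []. Qed.
Lemma lcoefZ a F p : (a *: F) p = a * F p. Proof. by []. Qed.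

(** The series x^M f: the ring laws are proved on this form, which every Laurent
    series takes. *)
Definition shift_coef M f : int -> K^o :=
  fun p => if p - M is Posz j then f j else 0.

Lemma shift_coef_subproof M f : shift_coef M f \in bounded_below.
Proof.
apply/asboolP; exists M => p pM; rewrite /shift_coef.
by case E : (p - M) => [j|//]; lia.
Qed.

Definition ser M f : laurent := Laurent (shift_coef_subproof M f).

Lemma serE M f (j : nat) : ser M f (M + j%:Z) = f j.
Proof. by rewrite /ser /= /shift_coef addrC addKr. Qed.

Lemma ser_lt M f p : p < M -> ser M f p = 0.
Proof. by move=> pM; rewrite /ser /= /shift_coef; case E : (p - M) => [j|//]; lia. Qed.

Lemma serP F M : (forall p, p < M -> F p = 0) -> F = ser M (fun j => F (M + j%:Z)).
Proof.
move=> FM; apply: laurentP => p.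
have [pM|Mp] := ltP p M; first by rewrite FM ?ser_lt.
have -> : p = M + `|p - M|%N%:Z by lia.
by rewrite serE.
Qed.

(** Two series need a common lower bound, hence all small bounds are kept. *)
Lemma lower F : exists M0 : int, forall M, M <= M0 -> forall p, p < M -> F p = 0.
Proof.
case: F => F FM /=; have /asboolP[M HM] := FM.
by exists M => N NM p pN; apply: HM; lia.
Qed.

Lemma ser_ex F : exists M f, F = ser M f.
Proof.
have [M HM] := lower F; exists M, (fun j => F (M + j%:Z)).
exact: serP (HM M (lexx _)).
Qed.

Lemma ser_ex2 F G : exists M f h, F = ser M f /\ G = ser M h.
Proof.
have [M HM] := lower F; have [N HN] := lower G.
pose L := Num.min M N; exists L, (fun j => F (L + j%:Z)), (fun j => G (L + j%:Z)).
split; apply: serP.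
  by apply: HM; rewrite ge_min lexx.
by apply: HN; rewrite ge_min lexx orbT.
Qed.

Lemma eq_ser M f h : f =1 h -> ser M f = ser M h.
Proof. by move=> /funext ->. Qed.

Lemma serD M f h : ser M f + ser M h = ser M (fun j => f j + h j).
Proof.
apply: laurentP => p; rewrite lcoefD /ser /= /shift_coef.
by case: (p - M) => // n; rewrite addr0.
Qed.

Lemma serZ a M f : a *: ser M f = ser M (fun j => a * f j).
Proof.
apply: laurentP => p; rewrite lcoefZ /ser /= /shift_coef.
by case: (p - M) => // n; rewrite mulr0.
Qed.

Lemma laurent_mul_ser M N f h :
  laurent_mul (ser M f) (ser N h) = ser (M + N) (fps_mul f h).
Proof.
apply/funext => q; rewrite /laurent_mul.
have [qMN|MNq] := ltP q (M + N).
  rewrite ser_lt// fsbig1// => p _.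
  have [pM|Mp] := ltP p M; first by rewrite ser_lt// scale0r.
  by rewrite [X in _ *: X]ser_lt ?scaler0//; lia.
have -> : q = M + N + `|(q - (M + N))%R|%N%:Z by lia.
move: (`|(q - (M + N))%R|%N) => k; rewrite serE {q MNq}.
rewrite (@fsbig_box _ M k.+1); first last.
- by move=> p pk; rewrite [X in _ *: X]ser_lt ?scaler0//; lia.
- by move=> p pM; rewrite ser_lt ?scale0r.
apply: eq_bigr => i _; have := ltn_ord i; move: (nat_of_ord i) => j jk; rewrite serE.
have -> : M + N + k%:Z - (M + j%:Z) = N + (k - j)%N%:Z by lia.
by rewrite serE.
Qed.

Lemma laurent_mul_subproof F G : laurent_mul F (G : int -> K^o) \in bounded_below.
Proof.
have [M [f ->]] := ser_ex F; have [N [h ->]] := ser_ex G.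
by rewrite laurent_mul_ser; exact: shift_coef_subproof.
Qed.

Definition lmul F G : laurent := Laurent (laurent_mul_subproof F G).

Lemma lmul_ser M N f h : lmul (ser M f) (ser N h) = ser (M + N) (fps_mul f h).
Proof. by apply/val_inj; exact: laurent_mul_ser. Qed.

(** Below degree N a power series is its N-th truncation: this reduces the ring
    laws of power series to those of polynomials. *)
Lemma fps_mul_poly f h N k : (k < N)%N ->
  fps_mul f h k = (\poly_(i < N) f i * \poly_(i < N) h i)`_k.
Proof.
move=> kN; rewrite coefM; apply: eq_bigr => -[i /= ik] _.
by rewrite !coef_poly !ifT//; lia.
Qed.

Lemma fps_mulC f h : fps_mul f h =1 fps_mul h f.
Proof. by move=> k; rewrite !(@fps_mul_poly _ _ k.+1)// mulrC. Qed.

Lemma fps_mulA f h e : fps_mul f (fps_mul h e) =1 fps_mul (fps_mul f h) e.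
Proof.
move=> k; pose tr (f : nat -> K) := \poly_(i < k.+1) f i.
transitivity ((tr f * (tr h * tr e))`_k).
  rewrite coefM; apply: eq_bigr => -[i /= ik] _.
  by rewrite coef_poly ifT// (@fps_mul_poly _ _ k.+1)//; lia.
rewrite mulrA coefM; apply: eq_bigr => -[i /= ik] _.
rewrite [X in _ * X = _]coef_poly ifT ?(@fps_mul_poly _ _ k.+1)//; lia.
Qed.

Lemma fps_mulDr f h e : fps_mul f (fun j => h j + e j) =1
  fun k => fps_mul f h k + fps_mul f e k.
Proof. by move=> k; rewrite -big_split; apply: eq_bigr => i _; rewrite mulrDr. Qed.

Lemma fps_mulZl a f h : fps_mul (fun j => a * f j) h =1 fun k => a * fps_mul f h k.
Proof. by move=> k; rewrite mulr_sumr; apply: eq_bigr => i _; rewrite mulrA. Qed.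

Lemma fps_mul1 f : fps_mul (fps_one K) f =1 f.
Proof.
move=> k; rewrite /fps_mul big_ord_recl/= /fps_one mul1r subn0 big1 ?addr0// => i _.
by rewrite mul0r.
Qed.

Definition lone : laurent := ser 0 (fps_one K).

Lemma lmulC : commutative lmul.
Proof.
move=> F G; have [M [f ->]] := ser_ex F; have [N [h ->]] := ser_ex G.
by rewrite !lmul_ser addrC; apply/eq_ser/fps_mulC.
Qed.

Lemma lmulA : associative lmul.
Proof.
move=> F G H; have [M [f ->]] := ser_ex F; have [N [h ->]] := ser_ex G.
have [L [e ->]] := ser_ex H.
by rewrite !lmul_ser addrA; apply/eq_ser/fps_mulA.
Qed.

Lemma lmul1 : left_id lone lmul.
Proof.
move=> F; have [M [f ->]] := ser_ex F.
by rewrite lmul_ser add0r; apply/eq_ser/fps_mul1.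
Qed.

Lemma lmulDl : left_distributive lmul +%R.
Proof.
move=> F G H; rewrite ![lmul _ H]lmulC.
have [M [f [h [-> ->]]]] := ser_ex2 F G; have [N [e ->]] := ser_ex H.
by rewrite serD !lmul_ser serD; apply/eq_ser/fps_mulDr.
Qed.

Lemma lone_neq0 : lone != 0.
Proof.
apply/eqP => /(congr1 (fun F : laurent => F 0)).
by rewrite -[X in lone X]addr0 serE => /eqP; rewrite oner_eq0.
Qed.

HB.instance Definition _ := GRing.Zmodule_isComNzRing.Build laurent
  lmulA lmulC lmul1 lmulDl lone_neq0.

Lemma mul_ser M N f h : ser M f * ser N h = ser (M + N) (fps_mul f h).
Proof. exact: lmul_ser. Qed.

Lemma laurent_scaleAl a F G : a *: (F * G) = a *: F * G.
Proof.
have [M [f ->]] := ser_ex F; have [N [h ->]] := ser_ex G.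
rewrite serZ !mul_ser serZ; apply: eq_ser => k.
by rewrite fps_mulZl.
Qed.

HB.instance Definition _ := GRing.Lmodule_isLalgebra.Build K laurent laurent_scaleAl.
HB.instance Definition _ := GRing.Lalgebra_isComAlgebra.Build K laurent.

End Laurent.

(** * Calculus of Laurent series *)

Section LaurentCalculus.
Variable K : numFieldType.
Implicit Types (F G H : laurent K) (f h : nat -> K) (M : int).

Lemma laurent1E : 1 = ser 0 (fps_one K). Proof. by []. Qed.

Lemma gbinom0 k : gbinom K k 0 = 1.
Proof. by rewrite /gbinom big_ord0 invr1 mulr1. Qed.

Lemma gbinomS k i : i.+1%:R * gbinom K k i.+1 = (k%:~R - i%:R) * gbinom K k i.
Proof.
have f0 n : n`!%:R != 0 :> K by rewrite pnatr_eq0 -lt0n fact_gt0.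
rewrite /gbinom big_ord_recr/= factS natrM; field.
by rewrite f0 nat1r pnatr_eq0.
Qed.

Lemma gbinom1 k : gbinom K k 1 = k%:~R.
Proof. by have := gbinomS k 0; rewrite gbinom0 mul1r subr0 mulr1. Qed.

Lemma gbinom_small (k : nat) i : (k < i)%N -> gbinom K k i = 0.
Proof.
move=> ki; rewrite /gbinom; apply/eqP; rewrite mulf_eq0; apply/orP; left.
by rewrite (bigD1 (Ordinal ki))//= -pmulrn subrr mul0r.
Qed.

(** The divided derivative F^(i) / i!, which keeps Taylor expansions free of
    factorials; [hasse 1] is d/dx. *)
Lemma hasse_subproof i F :
  (fun p : int => gbinom K (p + i%:Z) i * F (p + i%:Z)) \in @bounded_below K.
Proof.
have [M [f ->]] := ser_ex F; apply/asboolP; exists (M - i%:Z) => p pM.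
by rewrite ser_lt ?mulr0//; lia.
Qed.
Definition hasse i F : laurent K := Laurent (hasse_subproof i F).

Lemma hasseE i F p : hasse i F p = gbinom K (p + i%:Z) i * F (p + i%:Z).
Proof. by []. Qed.

Lemma hasse_ser i M f :
  hasse i (ser M f) = ser (M - i%:Z) (fun j => gbinom K (M + j%:Z) i * f j).
Proof.
apply: laurentP => p; rewrite hasseE.
have [pM|Mp] := ltP p (M - i%:Z).
  by rewrite !ser_lt ?mulr0//; lia.
have -> : p = M - i%:Z + `|(p - (M - i%:Z))%R|%N%:Z by lia.
move: (absz _) => k; rewrite serE addrAC subrK serE//.
Qed.

Lemma hasse0 F : hasse 0 F = F.
Proof. by apply: laurentP => p; rewrite hasseE gbinom0 addr0 mul1r. Qed.

Lemma hasseS i F : i.+1%:R *: hasse i.+1 F = hasse 1 (hasse i F).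
Proof.
apply: laurentP => p; rewrite lcoefZ !hasseE [LHS]mulrA gbinomS gbinom1 [RHS]mulrA.
have -> : p + i.+1%:Z = p + 1%:Z + i%:Z by lia.
congr (_ * _ * _); rewrite !intrD -pmulrn; ring.
Qed.

Lemma hasse_linear i : linear (hasse i).
Proof.
move=> a F G; apply: laurentP => p.
rewrite lcoefD lcoefZ !hasseE lcoefD lcoefZ; ring.
Qed.
HB.instance Definition _ i :=
  GRing.isLinear.Build K (laurent K) (laurent K) _ (hasse i) (hasse_linear i).

Local Notation lderiv := (hasse 1).

Lemma lderivE F p : lderiv F p = (p + 1)%:~R * F (p + 1).
Proof. by rewrite hasseE gbinom1. Qed.

Lemma lderivM F G : lderiv (F * G) = lderiv F * G + F * lderiv G.
Proof.
have [M [f ->]] := ser_ex F; have [N [h ->]] := ser_ex G.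
rewrite !mul_ser !hasse_ser !mul_ser.
have -> : M - 1%:Z + N = M + N - 1%:Z by lia.
have -> : M + (N - 1%:Z) = M + N - 1%:Z by lia.
rewrite serD; apply: eq_ser => k; rewrite /fps_mul mulr_sumr -big_split.
apply: eq_bigr => -[j /= jk] _; rewrite !gbinom1.
have -> : M + N + k%:Z = (M + j%:Z) + (N + (k - j)%N%:Z) by lia.
by rewrite [in LHS]intrD; ring.
Qed.

(** Exact series have no residue. *)
Lemma residue_deriv F : lderiv F (-1) = 0.
Proof. by rewrite lderivE addNr mul0r. Qed.

(** The series F(- x). *)
Lemma negx_subproof F : (fun p : int => (-1) ^ p * F p) \in @bounded_below K.
Proof.
have [M [f ->]] := ser_ex F; apply/asboolP; exists M => p pM.
by rewrite ser_lt ?mulr0.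
Qed.
Definition negx F : laurent K := Laurent (negx_subproof F).

Lemma negxE F p : negx F p = (-1) ^ p * F p. Proof. by []. Qed.

Lemma negx_ser M f : negx (ser M f) = ser M (fun j => (-1) ^ (M + j%:Z) * f j).
Proof.
apply: laurentP => p; rewrite negxE.
have [pM|Mp] := ltP p M; first by rewrite !ser_lt ?mulr0.
have -> : p = M + `|(p - M)%R|%N%:Z by lia.
by rewrite !serE.
Qed.

Lemma negx_linear : linear negx.
Proof.
move=> a F G; apply: laurentP => p.
by rewrite lcoefD lcoefZ !negxE lcoefD lcoefZ; ring.
Qed.
HB.instance Definition _ :=
  GRing.isLinear.Build K (laurent K) (laurent K) _ negx negx_linear.

Lemma signrzD (p q : int) : (-1) ^ (p + q) = (-1) ^ p * (-1) ^ q :> K.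
Proof. by rewrite expfzDr// oppr_eq0 oner_eq0. Qed.

Lemma negx_monoid : monoid_morphism negx.
Proof.
split.
  rewrite laurent1E negx_ser; apply: eq_ser => -[|k]; last first.
    by rewrite mulr0.
  by rewrite /fps_one eqxx mulr1.
move=> F G; have [M [f ->]] := ser_ex F; have [N [h ->]] := ser_ex G.
rewrite !mul_ser !negx_ser mul_ser; apply: eq_ser => k.
rewrite /fps_mul mulr_sumr; apply: eq_bigr => -[j /= jk] _.
have -> : M + N + k%:Z = (M + j%:Z) + (N + (k - j)%N%:Z) by lia.
by rewrite [in LHS]signrzD; ring.
Qed.
HB.instance Definition _ :=
  GRing.isMonoidMorphism.Build (laurent K) (laurent K) negx negx_monoid.

Definition expo (a : K) : laurent K := ser 0 (fps_exp a).

Lemma expoD a b : expo (a + b) = expo a * expo b.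
Proof.
rewrite /expo mul_ser addr0; apply: eq_ser => k; rewrite /fps_exp /fps_mul.
rewrite addrC exprDn mulr_suml; apply: eq_bigr => -[j /= jk] _.
have f0 n : n`!%:R != 0 :> K by rewrite pnatr_eq0 -lt0n fact_gt0.
have := @bin_fact k j jk => /(congr1 (fun n => n%:R : K)); rewrite !natrM => <-.
rewrite -mulr_natl; field.
by rewrite !f0/= pnatr_eq0 -lt0n bin_gt0.
Qed.

Lemma expo0 : expo 0 = 1.
Proof.
rewrite laurent1E; apply: eq_ser => -[|k].
  by rewrite /fps_exp expr0 divr1.
by rewrite /fps_exp expr0n mul0r.
Qed.

Lemma expo_nat (n : nat) : expo n%:R = expo 1 ^+ n.
Proof.
by elim: n => [|n IH]; [rewrite expo0 expr0 | rewrite -natr1 expoD IH exprSr].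
Qed.

Lemma lderiv_expo a : lderiv (expo a) = a *: expo a.
Proof.
apply: laurentP => p; rewrite lderivE lcoefZ.
have [p0|p0] := ltP p 0.
  rewrite [X in _ = _ * X]ser_lt// mulr0.
  have [->|p1] := eqVneq p (-1); first by rewrite mul0r.
  by rewrite ser_lt ?mulr0//; lia.
have -> : p = `|p|%N%:Z by lia.
move: (absz _) => k.
have -> : k%:Z + 1 = 0 + k.+1%:Z by lia.
rewrite serE -[X in expo a X]add0r serE add0r /fps_exp factS natrM exprS -pmulrn.
have f0 : k`!%:R != 0 :> K by rewrite pnatr_eq0 -lt0n fact_gt0.
by field; rewrite f0 nat1r pnatr_eq0.
Qed.

Lemma lderiv1 : lderiv (1 : laurent K) = 0.
Proof. by rewrite -expo0 lderiv_expo scale0r. Qed.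

Lemma negx_expo a : negx (expo a) = expo (- a).
Proof.
rewrite /expo negx_ser; apply: eq_ser => k.
by rewrite /fps_exp add0r exprNn mulrA -exprnP.
Qed.

(** The expansion of y = 1 / (e^x - 1), the generating series of the Bernoulli
    numbers. *)
Definition bern : laurent K := ser (-1) (fps_inv (fps_expm1X K)).

(** x ((e^x - 1) / x) = e^x - 1, and [fps_inv] inverts (e^x - 1) / x. *)
Lemma expm1_bern : (expo 1 - 1) * bern = 1.
Proof.
have -> : expo 1 - 1 = ser 1 (fps_expm1X K).
  apply/eqP; rewrite subr_eq addrC laurent1E; apply/eqP/laurentP => p.
  have [p0|p0] := ltP p 0; first by rewrite lcoefD !ser_lt ?addr0//; lia.
  have -> : p = `|p|%N%:Z by lia.
  case: (absz _) => [|k]; rewrite lcoefD -[X in expo 1 X]add0r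
    -[X in ser 0 (fps_one K) X]add0r !serE.
    by rewrite ser_lt// addr0 /fps_exp expr0 divr1.
  by rewrite /fps_exp /fps_one /= add0r expr1n mul1r.
rewrite /bern mul_ser laurent1E; apply: eq_ser.
by apply: fps_mulV; rewrite /fps_expm1X factS fact0 invr1.
Qed.

Lemma expo1_bern : expo 1 * bern = 1 + bern.
Proof. by rewrite -expm1_bern; ring. Qed.

(** Differentiate (e^x - 1) y = 1 and multiply by y. *)
Lemma lderiv_bern : lderiv bern = - bern - bern ^+ 2.
Proof.
have := congr1 lderiv expm1_bern; rewrite lderivM linearB/= lderiv_expo scale1r.
rewrite lderiv1 subr0 => /(congr1 ( *%R bern)); rewrite mulr0 => h.
have : lderiv bern = - bern * (expo 1 * bern).
  rewrite -[LHS]mul1r -expm1_bern; apply/eqP; rewrite -subr_eq0; apply/eqP.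
  by rewrite -[RHS]h; ring.
by rewrite expo1_bern => ->; ring.
Qed.

(** Apply x -> - x to (e^x - 1) y = 1 and multiply by e^x. *)
Lemma negx_bern : negx bern = - (expo 1 * bern).
Proof.
have := congr1 negx expm1_bern; rewrite rmorphM rmorphB/= rmorph1 negx_expo => h.
have e1 : expo (-1) * expo 1 = 1 by rewrite -expoD addNr expo0.
rewrite -[LHS]mul1r -e1 mulrAC.
have -> : expo (-1) * negx bern = expo (-1) * negx bern * ((expo 1 - 1) * bern).
  by rewrite expm1_bern mulr1.
have -> : expo (-1) * negx bern * ((expo 1 - 1) * bern) * expo 1
  = - ((expo (-1) - expo (-1) * expo 1) * negx bern) * (expo 1 * bern) by ring.
by rewrite e1 h mulN1r.
Qed.

Lemma exp_kernelE a m : exp_kernel a m = (expo a * bern ^+ m : laurent K).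
Proof.
have bX : bern ^+ m = ser (- m%:Z) (fps_pow (fps_inv (fps_expm1X K)) m).
  elim: m => [|m IH]; first by rewrite expr0.
  by rewrite exprS IH mul_ser -opprD -[1%:Z + _]PoszD add1n.
rewrite bX mul_ser add0r; apply/funext => p.
by rewrite /exp_kernel /= /shift_coef opprK.
Qed.

End LaurentCalculus.

(** * The kernels of the products *)

Section Kernels.
Variable K : numFieldType.
Local Notation lderiv := (hasse 1).
Local Notation bern := (bern K).
Implicit Types (F G : laurent K) (p q : {poly K}).

Lemma lderiv_bernX m : lderiv (bern ^+ m) = - m%:R *: (bern ^+ m * (1 + bern)).
Proof.
elim: m => [|m IH].
  by rewrite expr0 oppr0 scale0r lderiv1.
rewrite exprS lderivM IH lderiv_bern !scaleNr !scaler_nat; ring.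
Qed.

Lemma lderiv_horner_bern p :
  lderiv (horner_alg bern p) = horner_alg bern (deriv p * (- 'X - 'X ^+ 2)).
Proof.
elim/poly_ind: p => [|p c IH]; first by rewrite deriv0 mul0r !linear0.
rewrite derivD derivM derivX derivC mulr1 addr0 !(rmorphD, rmorphM, rmorphN, rmorphB, rmorphXn)/=.
rewrite linearD/= lderivM IH horner_algX horner_algC lderiv_bern.
rewrite !(rmorphD, rmorphM, rmorphN, rmorphB, rmorphXn)/= horner_algX.
rewrite linearZ/= lderiv1 scaler0 addr0.
ring.
Qed.

(** With z = e^x and y = 1/(z - 1), the rational functions p(y) are those that
    are regular outside z = 1, the point oo included. So these series are z^a
    times the rational functions with a pole at most at z = 1 and a zero of order
    at least m at z = oo. *)
Definition kernel (a : K) (m : nat) F : Prop :=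
  exists p, F = expo a * bern ^+ m * horner_alg bern p.

Lemma kernel_gen a m : kernel a m (expo a * bern ^+ m).
Proof. by exists 1; rewrite rmorph1 mulr1. Qed.

Lemma kernelD a m F G : kernel a m F -> kernel a m G -> kernel a m (F + G).
Proof. by move=> [p ->] [q ->]; exists (p + q); rewrite rmorphD mulrDr. Qed.

Lemma kernelZ a m c F : kernel a m F -> kernel a m (c *: F).
Proof. by move=> [p ->]; exists (c *: p); rewrite linearZ/= mulr_algl scalerAr. Qed.

Lemma kernelM a b m k F G :
  kernel a m F -> kernel b k G -> kernel (a + b) (m + k) (F * G).
Proof.
move=> [p ->] [q ->]; exists (p * q); rewrite rmorphM expoD exprD; ring.
Qed.

(** Since e^(s x) y^t = (1 + y)^s y^(t - s), orders of vanishing above the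
    prescribed ones at z = 0 and at z = oo are harmless. *)
Lemma kernel_shift a m s t F : (s <= t)%N ->
  kernel (a + s%:R) (m + t) F -> kernel a m F.
Proof.
move=> st [p ->]; exists ((1 + 'X) ^+ s * 'X ^+ (t - s) * p).
rewrite !rmorphM !rmorphXn rmorphD rmorph1 /= horner_algX -expo1_bern.
rewrite expoD expo_nat exprMn exprD -{1}(subnKC st) exprD; ring.
Qed.

Lemma kernel_sum a m (I : finType) (P : pred I) (F : I -> laurent K) :
  (forall i, P i -> kernel a m (F i)) -> kernel a m (\sum_(i | P i) F i).
Proof.
move=> kF; elim/big_ind : _ => //; last exact: kernelD.
by exists 0; rewrite rmorph0 mulr0.
Qed.

Lemma kernel_deriv a m F : kernel a m F -> kernel a m (lderiv F).
Proof.
move=> [p ->]; rewrite !lderivM lderiv_expo lderiv_bernX lderiv_horner_bern.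
exists ((a%:P - m%:R * (1 + 'X)) * p + deriv p * (- 'X - 'X ^+ 2)).
rewrite !(rmorphD, rmorphM, rmorphN, rmorphB, rmorphXn, rmorph1, rmorph_nat)/=.
rewrite horner_algX horner_algC scaleNr scaler_nat -[a *: expo a]mulr_algl; ring.
Qed.

Lemma kernel_hasse a m i F : kernel a m F -> kernel a m (hasse i F).
Proof.
move=> kF; elim: i => [|i IH]; first by rewrite hasse0.
have -> : hasse i.+1 F = i.+1%:R^-1 *: lderiv (hasse i F).
  by rewrite -hasseS scalerA mulVf ?scale1r// pnatr_eq0.
exact/kernelZ/kernel_deriv.
Qed.

(** For i > 0 the derivative F^(i) only depends on F', which may lie in a smaller
    space than F. *)
Lemma kernel_hasseS a m i F : kernel a m (lderiv F) -> kernel a m (hasse i.+1 F).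
Proof.
move=> kF; elim: i => // i IH.
have -> : hasse i.+2 F = i.+2%:R^-1 *: lderiv (hasse i.+1 F).
  by rewrite -hasseS scalerA mulVf ?scale1r// pnatr_eq0.
exact/kernelZ/kernel_deriv.
Qed.

(** x -> - x is z -> 1/z, which exchanges the points 0 and oo. *)
Lemma kernel_negx a m F : kernel a m F -> kernel (m%:R - a) m (negx F).
Proof.
move=> [p ->]; exists ((-1) ^+ m * (p \Po (- (1 + 'X)))).
rewrite !rmorphM/= !rmorphXn/= negx_expo negx_bern rmorphN rmorph1.
have -> : negx (horner_alg bern p) = horner_alg bern (p \Po - (1 + 'X)).
  elim/poly_ind: p => [|p c IH]; first by rewrite comp_poly0 !linear0.
  rewrite comp_polyD comp_polyM comp_polyX comp_polyC.
  rewrite !(rmorphD, rmorphM)/= IH !horner_algC horner_algX negx_bern.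
  rewrite rmorphN rmorphD rmorph1 /= horner_algX expo1_bern.
  by rewrite linearZ/= rmorph1.
rewrite expoD expo_nat exprNn exprMn; ring.
Qed.

Lemma lderiv_kernel_gen a m : lderiv (expo a * bern ^+ m) =
  (a - m%:R) *: (expo a * bern ^+ m) - m%:R *: (expo a * bern ^+ m.+1).
Proof.
rewrite lderivM lderiv_expo lderiv_bernX exprSr scaleNr scalerBl !scaler_nat.
rewrite -scalerAl; ring.
Qed.

(** The derivative of e^(a x) y^(m+1) has no residue. *)
Lemma residue_kernel_genS a m :
  m.+1%:R * (expo a * bern ^+ m.+2) (-1) = (a - m.+1%:R) * (expo a * bern ^+ m.+1) (-1).
Proof.
have := residue_deriv (expo a * bern ^+ m.+1); rewrite lderiv_kernel_gen.
by rewrite -scaleNr lcoefD !lcoefZ mulNr => /eqP; rewrite subr_eq0 => /eqP.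
Qed.

Lemma residue_kernel_gen1 a : (expo a * bern ^+ 1) (-1) = 1.
Proof.
rewrite expr1 mul_ser add0r -[X in ser _ _ X]addr0 serE /fps_mul big_ord1 subn0.
rewrite /fps_exp expr0 divr1 mul1r /fps_inv big_ord1 /fps_pow/= /fps_one eqxx//.
Qed.

(** The residue is the binomial coefficient of a - 1 over m. *)
Lemma residue_kernel_neq0 a m : (forall j : nat, (0 < j <= m)%N -> a != j%:R) ->
  (expo a * bern ^+ m.+1) (-1) != 0.
Proof.
elim: m => [|m IH] ha; first by rewrite residue_kernel_gen1 oner_eq0.
have : m.+1%:R * (expo a * bern ^+ m.+2) (-1) != 0.
  rewrite residue_kernel_genS mulf_neq0//; first by rewrite subr_eq0 ha ?leqnn.
  by apply: IH => j /andP[j0 jm]; apply: ha; rewrite j0/=; lia.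
by apply: contra => /eqP ->; rewrite mulr0.
Qed.

(** The kernel P of the product. As the sum is the truncation of the binomial
    expansion of (1 + y)^(-l-1) = (1 - e^(-x))^(l+1) in powers of y, and the
    factor e^((l+1) x) y^(l+1) = (1 + y)^(l+1) is its inverse, P equals 1 at
    z = oo up to terms of order l + 1. *)
Definition bullet_kernel (l : nat) : laurent K :=
  \sum_(m < l.+1) ((-1) ^+ m * 'C(m + l, l)%:R) *:
    (expo l.+1%:R * bern ^+ (l + m + 1)).

Lemma bullet_kernel_kernel l : kernel l.+1%:R l.+1 (bullet_kernel l).
Proof.
apply: kernel_sum => m _; apply: kernelZ; apply: (@kernel_shift _ _ 0 m) => //.
rewrite addr0; have -> : (l + m + 1 = l.+1 + m)%N by lia.
exact: kernel_gen.
Qed.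

(** The sum telescopes under differentiation: only its last term contributes. *)
Lemma lderiv_bullet_kernel l :
  kernel l.+1%:R (2 * l + 2) (lderiv (bullet_kernel l)).
Proof.
pose c (m : nat) : K := (-1) ^+ m * 'C(m + l, l)%:R.
pose t (m : nat) : laurent K := (m%:R * c m) *: (expo l.+1%:R * bern ^+ (l + m + 1)).
have cS m : m.+1%:R * c m.+1 = - ((l + m + 1)%:R * c m).
  rewrite /c exprS.
  have := mul_bin_diag (m + l).+1 m => /(congr1 (fun n => n%:R : K)).
  have -> : ('C(m.+1 + l, l) = 'C((m + l).+1, m.+1))%N.
    by rewrite -[in RHS]bin_sub; [congr 'C(_, _); lia|lia].
  have -> : ('C(m + l, l) = 'C(m + l, m))%N by rewrite -[RHS]bin_sub; [congr 'C(_, _); lia|lia].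
  rewrite !natrM /= => h.
  have -> : m.+1%:R * (-1 * (-1) ^+ m * 'C((m + l).+1, m.+1)%:R)
    = - (-1) ^+ m * (m.+1%:R * 'C((m + l).+1, m.+1)%:R) :> K by ring.
  by rewrite -h (addnC l) addn1; ring.
have -> : lderiv (bullet_kernel l) = t l.+1.
  rewrite /bullet_kernel linear_sum/=.
  rewrite (eq_bigr (fun m : 'I_l.+1 => t m.+1 - t m)) => [|m _].
    rewrite -(big_mkord xpredT (fun m => t m.+1 - t m)) telescope_sumr//.
    by rewrite {2}/t mul0r scale0r subr0.
  rewrite linearZ/= lderiv_kernel_gen -/(c m) /t cS.
  rewrite scalerBr !scalerA.
  have -> : (l + m + 1).+1 = (l + m.+1 + 1)%N by lia.
  rewrite addrC; congr (_ + _).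
    by rewrite -scaleNr [c m * _]mulrC.
  rewrite -scaleNr; congr (_ *: _); rewrite !natrD -natr1; ring.
apply: kernelZ; have -> : (l + l.+1 + 1 = 2 * l + 2)%N by lia.
exact: kernel_gen.
Qed.

(** P(- x) vanishes at z = oo to the order to which P vanishes at z = 0. *)
Lemma bullet_kernel_negx l :
  kernel l.+1%:R (2 * l + 2) (negx (bullet_kernel l) * bullet_kernel l).
Proof.
have := kernelM (kernel_negx (bullet_kernel_kernel l)) (bullet_kernel_kernel l).
by rewrite subrr add0r; have -> : (l.+1 + l.+1 = 2 * l + 2)%N by lia.
Qed.

(** For the exponent l + 1 the factors a - j of the recursion run through
    l, l - 1, ..., 0: only the first term of P has a residue. *)
Lemma residue_kernel_bin (l m : nat) :
  (expo l.+1%:R * bern ^+ m.+1) (-1) = 'C(l, m)%:R.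
Proof.
elim: m => [|m IH]; first by rewrite residue_kernel_gen1 bin0.
have m0 : m.+1%:R != 0 :> K by rewrite pnatr_eq0.
apply: (mulfI m0); rewrite residue_kernel_genS IH.
rewrite -natrM mul_bin_left natrM; have [ml|lm] := leqP m l.
  by rewrite natrB// -!natr1; congr (_ * _); ring.
by rewrite bin_small// !mulr0.
Qed.

Lemma residue_bullet_kernel l : bullet_kernel l (-1) = 1.
Proof.
rewrite /bullet_kernel.
rewrite (big_morph (fun F : laurent K => F (-1)) (id1 := 0) (op1 := +%R))//.
rewrite big_ord_recl big1 => [|m _]; rewrite lcoefZ addn1 residue_kernel_bin.
  by rewrite addn0 add0n !binn !mulr1 addr0.
by rewrite ['C(l, _)]bin_small ?mulr0// -[X in (X < _)%N]addn0 ltn_add2l.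
Qed.

End Kernels.

(** * Laurent series acting through modes *)

Section Modes.
Variables (K : numFieldType) (V : lmodType K) (A : vertexAlgebra V).
Implicit Types (u v w : V) (F G : laurent K) (f h : nat -> K) (M N : int).
Local Notation lderiv := (hasse 1).
Local Notation mode := (vmode A).
Local Notation D := (translation A).

HB.instance Definition _ u n :=
  GRing.isLinear.Build K V V *:%R (vmode A u n) (vmode_linearr A u n).

(** The modes as functions of the first argument, so that the general lemmas on
    linear maps apply to it; likewise [kmode_flip] and [kmode_kernel] below. *)
Definition mode_flip n v u := vmode A u n v.
HB.instance Definition _ n v :=
  GRing.isLinear.Build K V V *:%R (mode_flip n v) (vmode_linearl A n v).
Lemma mode_flipE u n v : mode u n v = mode_flip n v u. Proof. by []. Qed.

Lemma translation_linear : linear D.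
Proof. exact: (vmode_linearl A). Qed.
HB.instance Definition _ :=
  GRing.isLinear.Build K V V *:%R (translation A) translation_linear.

Lemma truncation_ex u v : exists N : nat, forall n : int, N%:Z <= n -> mode u n v = 0.
Proof.
have [N HN] := vmode_truncation A u v; exists `|N|%N => n Nn; apply: HN; lia.
Qed.
Definition trunc_order u v : nat := projT1 (cid (truncation_ex u v)).
Lemma trunc_orderP u v n : (trunc_order u v)%:Z <= n -> mode u n v = 0.
Proof. exact: (projT2 (cid (truncation_ex u v))). Qed.

(** Res_x F(x) Y(u, x) v, that is, the sum of the F_p u_p v. *)
Definition kmode u F v : V := residue (laurent_mul F (vseries A u v)).

Lemma kmode_ser M f u v J : (trunc_order u v)%:Z <= M + J%:Z ->
  kmode u (ser M f) v = \sum_(j < J) f j *: mode u (M + j%:Z) v.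
Proof.
move=> uvJ; rewrite /kmode /residue /laurent_mul.
under eq_fsbigr => p _.
  rewrite /vseries (_ : - (-1 - p) - 1 = p); last lia.
  over.
rewrite (@fsbig_box _ M J).
- by apply: eq_bigr => j _; rewrite serE.
- by move=> p pM; rewrite ser_lt ?scale0r.
- by move=> p pJ; rewrite trunc_orderP ?scaler0//; lia.
Qed.

Lemma kmode_linear u F : linear (kmode u F).
Proof.
move=> a v w; have [M [f ->]] := ser_ex F.
pose J := (`|M| + trunc_order u v + trunc_order u w
  + trunc_order u (a *: v + w))%N.
rewrite !(@kmode_ser M f _ _ J); [|lia..].
rewrite scaler_sumr -big_split; apply: eq_bigr => j _.
by rewrite linearP/= scalerDr !scalerA mulrC.
Qed.
HB.instance Definition _ u F :=
  GRing.isLinear.Build K V V *:%R (kmode u F) (kmode_linear u F).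

Definition kmode_flip F v u := kmode u F v.
Lemma kmode_flip_linear F v : linear (kmode_flip F v).
Proof.
move=> a u w; rewrite /kmode_flip; have [M [f ->]] := ser_ex F.
pose J := (`|M| + trunc_order u v + trunc_order w v
  + trunc_order (a *: u + w) v)%N.
rewrite !(@kmode_ser M f _ _ J); [|lia..].
rewrite scaler_sumr -big_split; apply: eq_bigr => j _.
by rewrite mode_flipE linearP/= scalerDr !scalerA mulrC.
Qed.
HB.instance Definition _ F v :=
  GRing.isLinear.Build K V V *:%R (kmode_flip F v) (kmode_flip_linear F v).

Definition kmode_kernel u v F := kmode u F v.
Lemma kmode_kernel_linear u v : linear (kmode_kernel u v).
Proof.
move=> a F G; rewrite /kmode_kernel; have [M [f [h [-> ->]]]] := ser_ex2 F G.
rewrite serZ serD.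
pose J := (`|M| + trunc_order u v)%N.
rewrite !(@kmode_ser M _ _ _ J); [|lia..].
rewrite scaler_sumr -big_split; apply: eq_bigr => j _.
by rewrite scalerDl scalerA.
Qed.
HB.instance Definition _ u v :=
  GRing.isLinear.Build K (laurent K) V *:%R (kmode_kernel u v)
    (kmode_kernel_linear u v).

(** * Consequences of the Jacobi identity *)

Lemma gbinom_pred i : gbinom K (i%:Z - 1) i = (i == 0%N)%:R.
Proof.
case: i => [|i]; first exact: gbinom0.
by rewrite -[in i.+1%:Z - 1]addn1 PoszD addrK gbinom_small.
Qed.

Lemma gbinomN2 i : gbinom K (-2) i = (-1) ^+ i * i.+1%:R.
Proof.
elim: i => [|i IH]; first by rewrite gbinom0 mulr1.
have i0 : i.+1%:R != 0 :> K by rewrite pnatr_eq0.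
apply: (mulfI i0); rewrite gbinomS IH exprS -!natr1 mulrNz; ring.
Qed.

(** Reflection of the upper index of a binomial coefficient. *)
Lemma subX_coef_refl (m : int) i : subX_coef K (i%:Z - m - 1) i = gbinom K m i.
Proof.
rewrite /subX_coef /gbinom mulrA; congr (_ / _).
have -> : (-1) ^+ i = \prod_(j < i) (-1) :> K by rewrite prodr_const card_ord.
rewrite -big_split [RHS](reindex_inj rev_ord_inj)/=; apply: eq_bigr => j _.
have ji := ltn_ord j; rewrite natrB// !intrD !mulrNz -natr1 -!pmulrn; ring.
Qed.

(** The Jacobi identity with m = 0: on its right-hand side only the term i = 0
    survives, because its coefficients are the [gbinom_pred]. *)
Lemma mode_assoc u v w (p q : int) (I : nat) :
  (forall i : nat, (I <= i)%N -> mode v (q + i%:Z) w = 0) ->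
  (forall i : nat, (I <= i)%N -> mode u i%:Z w = 0) ->
  mode (mode u p v) q w =
  \sum_(i < I) subX_coef K p i *: mode u (p - i%:Z) (mode v (q + i%:Z) w)
  - \sum_(i < I) ((-1) ^ p * subX_coef K p i) *:
      mode v (p + q - i%:Z) (mode u i%:Z w).
Proof.
move=> vI uI; have := vertex_jacobi A u v w p 0 q.
rewrite (@fsbig_nat_box _ I) => [|i Ii]; last by rewrite vI// linear0 scaler0.
rewrite (@fsbig_nat_box _ I) => [|i Ii]; last by rewrite add0r uI// linear0 scaler0.
rewrite (@fsbig_nat_box _ 1) => [|i Ii]; last first.
  by rewrite subr0 /subX_coef gbinom_pred; case: i Ii => // i _; rewrite mulr0 scale0r.
rewrite big_ord1 /= /subX_coef gbinom0 expr0 mul1r scale1r !addr0 !add0r => <-.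
congr (_ - _).
rewrite scaler_sumr; apply: eq_bigr => i _.
by rewrite scalerA add0r [q + p]addrC.
Qed.

(** The Jacobi identity with l = 0: on its left-hand side only the terms i = 0
    survive. *)
Lemma mode_comm u v w (p q : int) (I : nat) :
  (forall i : nat, (I <= i)%N -> mode u i%:Z v = 0) ->
  mode u p (mode v q w) = mode v q (mode u p w)
  + \sum_(i < I) gbinom K p i *: mode (mode u i%:Z v) (p + q - i%:Z) w.
Proof.
move=> uI; have := vertex_jacobi A u v w 0 p q.
have g0 (i : nat) : (1 <= i)%N -> subX_coef K 0 i = 0.
  by move=> i0; rewrite /subX_coef (@gbinom_small _ 0)// mulr0.
do 2![rewrite (@fsbig_nat_box _ 1); last by move=> i i1; rewrite g0// scale0r].
rewrite (@fsbig_nat_box _ I) => [|i Ii]; last first.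
  by rewrite add0r uI// mode_flipE linear0 scaler0.
rewrite !big_ord1 /= /subX_coef gbinom0 expr0z !mul1r !scale1r !addr0.
move=> /eqP; rewrite subr_eq addrC => /eqP ->; congr (_ + _).
by apply: eq_bigr => i _; rewrite -/(subX_coef _ _ _) subX_coef_refl add0r.
Qed.

Lemma mode_vacuum_ge0 u (n : int) : 0 <= n -> mode u n (vacuum A) = 0.
Proof. by move=> n0; rewrite mode_vacuum ?ifF//; lia. Qed.

(** The Jacobi identity for u_(-2) 1. In each of the two sums at most one mode of
    the vacuum is nonzero: in the first for n < 0, in the second for n > 0. *)
Lemma translation_mode u n v : mode (D u) n v = - n%:~R *: mode u (n - 1) v.
Proof.
pose I := (trunc_order u v + `|n|).+1.
rewrite (@mode_assoc _ _ _ _ _ I); first last.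
- by move=> i Ii; rewrite trunc_orderP//; lia.
- by move=> i Ii; rewrite vacuum_mode ifF//; lia.
have coefE i : subX_coef K (-2) i = i.+1%:R.
  by rewrite /subX_coef gbinomN2 mulrA -expr2 sqrr_sign mul1r.
have [n0|n0] := leP 1 n.
  rewrite big1 ?sub0r => [|i _]; last by rewrite vacuum_mode ifF ?linear0 ?scaler0//; lia.
  have iI : (`|n - 1| < I)%N by rewrite /I; lia.
  rewrite (bigD1 (Ordinal iI))//= big1 ?addr0 => [|i ine]; last first.
    rewrite vacuum_mode ifF ?scaler0//; apply/negP => /eqP h; case/negP: ine.
    by apply/eqP/val_inj => /=; lia.
  rewrite vacuum_mode ifT; last lia.
  rewrite coefE scaleNr (_ : (-1) ^ (-2) = 1) ?mul1r; last first.
    by rewrite -exprnN sqrrN expr1n invr1.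
  by congr (- (_ *: mode _ _ _)); [rewrite pmulrn; congr (_%:~R)|]; lia.
rewrite [X in _ - X]big1 ?subr0 => [|i _]; last by rewrite vacuum_mode ifF ?scaler0//; lia.
have [->|nn0] := eqVneq n 0.
  rewrite big1 ?oppr0 ?scale0r// => i _.
  by rewrite vacuum_mode /= linear0 scaler0.
have iI : (`|(n + 1)%R| < I)%N by rewrite /I; lia.
rewrite (bigD1 (Ordinal iI))//= big1 ?addr0 => [|i ine]; last first.
  rewrite vacuum_mode ifF ?linear0 ?scaler0//; apply/negP => /eqP h; case/negP: ine.
  by apply/eqP/val_inj => /=; lia.
rewrite vacuum_mode ifT; last lia.
rewrite coefE; congr (_ *: mode _ _ _); last lia.
by rewrite pmulrn -mulrNz; congr (_%:~R); lia.
Qed.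

(** The Jacobi identity for (u_n v)_(-2) 1, in which only the first two terms on
    the left survive. *)
Lemma translation_derivation u n v :
  D (mode u n v) = mode u n (D v) + mode (D u) n v.
Proof.
rewrite {1}/translation (@mode_assoc _ _ _ _ _ 2); first last.
- by move=> i _; exact: mode_vacuum_ge0.
- by move=> i i2; apply: mode_vacuum_ge0; lia.
rewrite [X in _ - X]big1 ?subr0 => [|i _]; last by rewrite mode_vacuum_ge0 ?linear0 ?scaler0.
rewrite big_ord_recl big_ord1 /= !addr0 -/(D v) (_ : bump 0 0 = 1%N)//.
rewrite (@mode_vacuum _ _ A v (-2 + 1%:Z))//=.
rewrite /subX_coef gbinom0 gbinom1 expr0 mul1r scale1r translation_mode.
by rewrite expr1 mulN1r.
Qed.

(** The creation property Y(u, x) 1 = e^(x D) u, modulo the image of D: repeated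
    use of [translation_mode] lowers the index to -2. *)
Lemma mode_vacuum_translation u (k : nat) :
  exists w, mode u (- (k%:Z + 2)) (vacuum A) = D w.
Proof.
elim: k u => [|k IH] u; first by exists u.
have [w] := IH (D u); rewrite translation_mode mulrNz opprK => uw.
have k0 : (k%:Z + 2)%:~R != 0 :> K by rewrite intr_eq0; lia.
exists ((k%:Z + 2)%:~R^-1 *: w); rewrite linearZ/= -uw scalerA mulVf//.
by rewrite scale1r; congr (mode _ _ _); lia.
Qed.

Lemma kmode_vacuum u F : exists w, kmode u F (vacuum A) = F (-1) *: u + D w.
Proof.
have [M0 HM] := lower F; pose k := `|M0|%N; pose M := - (k%:Z + 1).
have FE : F = ser M (fun j => F (M + j%:Z)) by apply/serP/HM; lia.
have mode0 p : M + k.+1%:Z <= p -> mode u p (vacuum A) = 0.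
  by move=> Mp; apply: mode_vacuum_ge0; lia.
rewrite {1}FE /kmode /residue /laurent_mul -FE.
under eq_fsbigr => p _.
  rewrite /vseries (_ : - (-1 - p) - 1 = p); last lia.
  over.
rewrite (@fsbig_box _ M k.+1); first last.
- by move=> p pJ; rewrite mode0// scaler0.
- by move=> p pM; rewrite FE ser_lt ?scale0r.
rewrite big_ord_recr/= (_ : M + k%:Z = -1); last lia.
rewrite mode_vacuum//= addrC.
have h (j : 'I_k) : exists w, mode u (M + j%:Z) (vacuum A) = D w.
  have [w uw] := mode_vacuum_translation u (k - j.+1); exists w; rewrite -uw.
  by congr (mode _ _ _); have := ltn_ord j; rewrite /M; lia.
pose w j := projT1 (cid (h j)).
exists (\sum_(j < k) F (M + j%:Z) *: w j); rewrite linear_sum; congr (_ + _).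
by apply: eq_bigr => j _; rewrite linearZ/= (projT2 (cid (h j))).
Qed.

(** Integration by parts. *)
Lemma kmode_translation u F v : kmode (D u) F v = - kmode u (lderiv F) v.
Proof.
have [M [f ->]] := ser_ex F; rewrite hasse_ser.
pose J := (`|M| + 1 + trunc_order u v + trunc_order (D u) v)%N.
rewrite !(@kmode_ser _ _ _ _ J); [|lia..].
rewrite -sumrN; apply: eq_bigr => j _.
rewrite translation_mode gbinom1 scalerA -scaleNr mulrN [f j * _]mulrC.
by congr (_ *: mode _ _ _); lia.
Qed.

Lemma translation_kmode u F v : D (kmode u F v) = kmode u F (D v) + kmode (D u) F v.
Proof.
have [M [f ->]] := ser_ex F.
pose J := (`|M| + trunc_order u v + trunc_order u (D v) + trunc_order (D u) v)%N.
rewrite !(@kmode_ser _ _ _ _ J); [|lia..].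
rewrite linear_sum -big_split; apply: eq_bigr => j _.
by rewrite linearZ/= translation_derivation scalerDr.
Qed.

End Modes.

(** * Associativity and commutators against Laurent kernels *)

Section KernelAssociativity.
Variables (K : numFieldType) (V : lmodType K) (A : vertexAlgebra V).
Implicit Types (u v w : V) (F G : laurent K) (f h : nat -> K) (M N : int).
Local Notation mode := (vmode A).
Local Notation tord := (trunc_order A).

(** Summation over the triangle i + k < J against summation over the square:
    they differ by terms in which X vanishes. *)
Lemma cauchy_product_square f h (X : nat -> V) (J : nat) :
  (forall k, (J <= k)%N -> X k = 0) ->
  \sum_(k < J) fps_mul f h k *: X k
  = \sum_(i < J) \sum_(k < J) (f i * h k) *: X (i + k)%N.
Proof.
move=> XJ; pose a i n := (f i * h (n - i)%N) *: X n.
transitivity (\sum_(n < J) \sum_(i < J | (i <= n)%N) a i n).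
  apply: eq_bigr => n _; rewrite scaler_suml.
  rewrite (big_ord_widen J (fun i => (f i * h (n - i)%N) *: X n)) ?ltn_ord//.
rewrite (exchange_big_dep xpredT)//=; apply: eq_bigr => -[i iJ] _ /=.
rewrite -(big_mkord (fun n => (i <= n)%N) (a i)).
rewrite (@big_cat_nat _ _ _ i)//= 1?ltnW//.
rewrite big_nat_cond big1 ?add0r => [|n /andP[/andP[_ ni] ni']]; last by lia.
rewrite big_nat_cond (eq_bigl (fun n => (i <= n < J)%N)) => [|n]; last by lia.
rewrite -big_nat -{1}(add0n i) big_addn.
rewrite -(big_mkord xpredT (fun k => (f i * h k) *: X (i + k)%N)).
rewrite [RHS](@big_cat_nat _ _ _ (J - i))//= ?leq_subr//.
rewrite [X in _ = _ + X]big_nat_cond [X in _ = _ + X]big1 ?addr0; last first.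
  by move=> k /andP[/andP[kJ _] _]; rewrite XJ ?scaler0//; lia.
by apply: eq_bigr => k _; rewrite /a addnK addnC.
Qed.

Lemma kmode_mul_ser M N f h u v J : (tord u v)%:Z <= M + N + J%:Z ->
  kmode A u (ser M f * ser N h) v =
  \sum_(i < J) \sum_(k < J) (f i * h k) *: mode u (M + i%:Z + (N + k%:Z)) v.
Proof.
move=> uvJ; rewrite mul_ser (kmode_ser _ uvJ).
rewrite (cauchy_product_square _ _ (X := fun k => mode u (M + N + k%:Z) v)).
  apply: eq_bigr => i _; apply: eq_bigr => k _; congr (_ *: mode _ _ _); lia.
by move=> k Jk; apply: trunc_orderP; lia.
Qed.

Lemma signrz_sub M (i : nat) : (-1) ^ (M - i%:Z) = (-1) ^ M * (-1) ^+ i :> K.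
Proof.
rewrite signrzD; congr (_ * _); rewrite -exprnN -exprVn; congr (_ ^+ _).
by rewrite invrN1.
Qed.

(** Put x1 = x0 + x2 in the Jacobi identity, and expand F(x1 - x2) in powers of
    x2 where Y(u, x1) stands to the left of Y(v, x2), and in powers of x1 where it
    stands to the right. Membership in the subspace divided out depends only on the
    kernels, hence the existentially quantified vectors y i and z i. *)
Lemma kmode_assoc u v w F G : exists (I : nat) (y z : nat -> V),
  kmode A (kmode A u F v) G w = kmode A u F (kmode A v G w)
  + \sum_(i < I) kmode A u (hasse i.+1 F) (y i)
  + \sum_(i < I) kmode A v (negx (hasse i F) * G) (z i).
Proof.
have [M [f ->]] := ser_ex F; have [N [h ->]] := ser_ex G.
(* For i >= I both modes in the i-th term of the Jacobi identity vanish. *)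
pose I := (`|N| + tord v w + tord u w).+1.
pose y i := kmode A v (ser (N + i%:Z) h) w.
pose z i := mode u i%:Z w.
(* All series may be cut after J terms; this makes every sum below finite. *)
pose J := (`|M| + `|N| + I + tord u v + tord v w
  + tord (kmode A u (ser M f) v) w
  + \sum_(i < I) (tord u (y i) + tord v (z i)))%N.
have Jy i : (i < I)%N -> (tord u (y i))%:Z <= M - i%:Z + J%:Z.
  by move=> iI; rewrite /J (bigD1 (Ordinal iI))//=; lia.
have Jz i : (i < I)%N -> (tord v (z i))%:Z <= M - i%:Z + N + J%:Z.
  by move=> iI; rewrite /J (bigD1 (Ordinal iI))//=; lia.
exists I, (fun i => if i.+1 == I then 0 else (-1) ^+ i.+1 *: y i.+1), (fun i => - z i).
have y0 : y 0 = kmode A v (ser N h) w by rewrite /y addr0.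
(* The term i = 0 of the first sum is u_F (v_G w). The last y i is 0, which
   pads the sum over 0 < i < I to I terms. *)
transitivity (\sum_(i < I) ((-1) ^+ i *: kmode A u (hasse i (ser M f)) (y i)
   - kmode A v (negx (hasse i (ser M f)) * ser N h) (z i))); last first.
  rewrite big_split/= sumrN; congr (_ + _); last first.
    by rewrite -sumrN; apply: eq_bigr => i _; rewrite linearN.
  rewrite [in LHS]/I big_ord_recl /= expr0 scale1r hasse0 y0; congr (_ + _).
  rewrite [in RHS]/I [RHS]big_ord_recr /= eqxx linear0 addr0; apply: eq_bigr => i _.
  rewrite ifF ?linearZ//.
  by apply/negP => /eqP[]; have := ltn_ord i; lia.
rewrite (@kmode_ser _ _ _ _ _ _ _ J); last by rewrite /J; lia.
rewrite (@kmode_ser _ _ _ _ _ _ _ J); last by rewrite /J; lia.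
transitivity (\sum_(j < J) \sum_(k < J) (f j * h k) *:
    mode (mode u (M + j%:Z) v) (N + k%:Z) w).
  rewrite exchange_big; apply: eq_bigr => k _.
  rewrite mode_flipE linear_sum scaler_sumr; apply: eq_bigr => j _.
  by rewrite linearZ scalerA mulrC.
transitivity (\sum_(j < J) \sum_(k < J) \sum_(i < I)
  ((f j * h k * subX_coef K (M + j%:Z) i) *:
     mode u (M + j%:Z - i%:Z) (mode v (N + k%:Z + i%:Z) w)
   - (f j * h k * ((-1) ^ (M + j%:Z) * subX_coef K (M + j%:Z) i)) *:
     mode v (M + j%:Z + (N + k%:Z) - i%:Z) (z i))).
  apply: eq_bigr => j _; apply: eq_bigr => k _.
  rewrite (@mode_assoc _ _ _ _ _ _ _ _ I); first last.
  - by move=> i Ii; apply: trunc_orderP; rewrite /I in Ii; lia.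
  - by move=> i Ii; apply: trunc_orderP; rewrite /I in Ii; lia.
  rewrite -sumrB scaler_sumr; apply: eq_bigr => i _.
  by rewrite scalerBr !scalerA.
under eq_bigr => j _ do rewrite exchange_big.
rewrite exchange_big; apply: eq_bigr => -[i /= iI] _.
under eq_bigr => j _ do rewrite sumrB.
rewrite sumrB; congr (_ - _).
  rewrite hasse_ser (kmode_ser _ (Jy i iI)) scaler_sumr.
  apply: eq_bigr => j _.
  rewrite /y (@kmode_ser _ _ _ _ _ _ _ J); last by rewrite /J; lia.
  rewrite linear_sum !scaler_sumr; apply: eq_bigr => k _.
  rewrite (linearZ_LR (vmode A u _)) !scalerA /subX_coef.
  have -> : M + j%:Z - i%:Z = M - i%:Z + j%:Z by lia.
  have -> : N + k%:Z + i%:Z = N + i%:Z + k%:Z by lia.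
  by congr (_ *: _); ring.
rewrite hasse_ser negx_ser (kmode_mul_ser _ _ (Jz i iI)).
apply: eq_bigr => j _; apply: eq_bigr => k _.
have -> : M - i%:Z + j%:Z = M + j%:Z - i%:Z by lia.
have -> : M + j%:Z + (N + k%:Z) - i%:Z = M + j%:Z - i%:Z + (N + k%:Z) by lia.
rewrite signrz_sub /subX_coef; congr (_ *: _); ring.
Qed.

(** Here x1 = x0 + x2 as well, and F(x2 + x0) is expanded in powers of x0. *)
Lemma kmode_comm u v w F G : exists I : nat,
  kmode A u F (kmode A v G w) = kmode A v G (kmode A u F w)
  + \sum_(i < I) kmode A (mode u i%:Z v) (hasse i F * G) w.
Proof.
have [M [f ->]] := ser_ex F; have [N [h ->]] := ser_ex G.
pose I := tord u v; pose x i := mode u i%:Z v.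
pose J := (`|M| + `|N| + I + tord u w + tord v w
  + tord u (kmode A v (ser N h) w) + tord v (kmode A u (ser M f) w)
  + \sum_(i < I) tord (x i) w)%N.
have Jx i : (i < I)%N -> (tord (x i) w)%:Z <= M - i%:Z + N + J%:Z.
  by move=> iI; rewrite /J (bigD1 (Ordinal iI))//=; lia.
exists I.
rewrite (@kmode_ser _ _ _ M _ _ _ J); last by rewrite /J; lia.
rewrite [X in _ = X + _](@kmode_ser _ _ _ _ _ _ _ J); last by rewrite /J; lia.
rewrite (@kmode_ser _ _ _ _ _ _ _ J); last by rewrite /J; lia.
rewrite (@kmode_ser _ _ _ M _ _ _ J); last by rewrite /J; lia.
transitivity (\sum_(j < J) \sum_(k < J) ((f j * h k) *:
     mode v (N + k%:Z) (mode u (M + j%:Z) w)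
   + \sum_(i < I) (f j * h k * gbinom K (M + j%:Z) i) *:
     mode (x i) (M + j%:Z + (N + k%:Z) - i%:Z) w)).
  apply: eq_bigr => j _; rewrite linear_sum scaler_sumr; apply: eq_bigr => k _.
  rewrite linearZ/= scalerA (@mode_comm _ _ _ _ _ _ _ _ I) => [|i Ii]; last first.
    by apply: trunc_orderP; rewrite /I in Ii; lia.
  rewrite scalerDr scaler_sumr; congr (_ + _); apply: eq_bigr => i _.
  by rewrite scalerA.
under eq_bigr => j _ do rewrite big_split.
rewrite big_split; congr (_ + _).
  rewrite exchange_big; apply: eq_bigr => k _.
  rewrite linear_sum scaler_sumr; apply: eq_bigr => j _.
  by rewrite linearZ/= scalerA mulrC.
under eq_bigr => j _ do rewrite exchange_big.
rewrite exchange_big; apply: eq_bigr => -[i /= iI] _.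
rewrite hasse_ser (kmode_mul_ser _ _ (Jx i iI)).
apply: eq_bigr => j _; apply: eq_bigr => k _.
have -> : M + j%:Z + (N + k%:Z) - i%:Z = M - i%:Z + j%:Z + (N + k%:Z) by lia.
by congr (_ *: _); ring.
Qed.

End KernelAssociativity.

(** * The twisted products *)

Section TwistedAlgebra.
Variables (R : realType) (V : lmodType R[i]) (A : vertexAlgebra V).
Variables (g : {linear V -> V}) (T : nat) (n : rat).
Hypothesis g_aut : vertex_automorphism A g.
Hypothesis g_order : has_order g T.
Hypothesis n_mult : exists N : nat, n = N%:R / T%:R.
Local Notation K := (R[i]).
Local Notation D := (translation A).
Local Notation eig := (eigspace g T).
Local Notation proj := (eigproj g T).
Local Notation lf := (nfloor n).
Local Notation nb := (nbar T n).
Implicit Types (u v w : V) (F G : laurent K) (r s : nat).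

Let T0 : (0 < T)%N. Proof. by case: g_order. Qed.
Let TK : T%:R != 0 :> K. Proof. by rewrite pnatr_eq0 -lt0n. Qed.

(** * The grading by the eigenspaces of g *)

Definition zeta r : K := cexpi (- (2 * pi * r%:R / T%:R)).

Lemma eigE r v : eig r v <-> g v = zeta r *: v. Proof. by []. Qed.

Lemma zetaD r s : zeta (r + s) = zeta r * zeta s.
Proof. by rewrite /zeta -cexpiD natrD; congr cexpi; ring. Qed.

Lemma zeta0 : zeta 0 = 1.
Proof. by rewrite /zeta mulr0 mul0r oppr0 cexpi0. Qed.

Lemma zeta_order : zeta T = 1.
Proof.
rewrite /zeta mulfK ?pnatr_eq0 -?lt0n//.
by rewrite -[LHS]mulr1 -{1}(cexpi_2pi R 1) -cexpiD mulr1 addNr cexpi0.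
Qed.

Lemma zeta_mod r : zeta (r %% T) = zeta r.
Proof.
rewrite [in RHS](divn_eq r T) zetaD; suff -> : zeta (r %/ T * T) = 1 by rewrite mul1r.
by elim: (r %/ T)%N => [|k IH]; rewrite ?zeta0// mulSn zetaD zeta_order mul1r.
Qed.

Lemma kmode_equivariant u F v : g (kmode A u F v) = kmode A (g u) F (g v).
Proof.
have [_ _ gm] := g_aut; have [M [f ->]] := ser_ex F.
pose J := (`|M| + trunc_order A u v + trunc_order A (g u) (g v))%N.
rewrite !(@kmode_ser _ _ _ _ _ _ _ J); [|lia..].
by rewrite linear_sum; apply: eq_bigr => j _; rewrite linearZ/= gm.
Qed.

Lemma eig_kmode r s u F v : eig r u -> eig s v -> eig ((r + s) %% T) (kmode A u F v).
Proof.
move=> /eigE ur /eigE vs; apply/eigE; rewrite kmode_equivariant ur vs zeta_mod zetaD.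
rewrite linearZ/= -[kmode _ _ _ _]/(kmode_flip A F v (zeta r *: u)) linearZ/=.
by rewrite scalerA mulrC.
Qed.

Lemma eig_mode0 r u k v : eig 0 u -> eig r v -> eig r (vmode A u k v).
Proof.
have [_ _ gm] := g_aut; move=> /eigE u0 /eigE vr; apply/eigE.
by rewrite gm u0 vr zeta0 scale1r linearZ.
Qed.

Lemma eig_vacuum : eig 0 (vacuum A).
Proof. by have [_ g1 _] := g_aut; apply/eigE; rewrite g1 zeta0 scale1r. Qed.

Lemma eig_translation r u : eig r u -> eig r (D u).
Proof.
have [_ g1 gm] := g_aut; move=> /eigE ur; apply/eigE.
by rewrite -linearZ/= -ur /translation gm g1.
Qed.

Lemma proj_eig r s v : (r < T)%N -> (s < T)%N -> eig s v ->
  proj r v = if r == s then v else 0.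
Proof.
move=> rT sT vs.
have := @eigproj_unique _ _ _ _ g_order
  (fun i : 'I_T => if i == Ordinal sT then v else 0) (Ordinal rT).
rewrite -big_mkcond big_pred1_eq => -> //= i.
by case: eqP => [->//|_]; apply/eigE; rewrite linear0 scaler0.
Qed.

Lemma proj_linear r : linear (proj r).
Proof.
move=> a u v; rewrite /eigproj [in RHS]scalerA [a * _]mulrC -scalerA -scalerDr; congr (_ *: _).
rewrite scaler_sumr -big_split; apply: eq_bigr => k _ /=.
have -> : iter k g (a *: u + v) = a *: iter k g u + iter k g v.
  by elim: (nat_of_ord k) => // j IH; rewrite !iterS IH linearP.
by rewrite scalerDr !scalerA [a * _]mulrC.
Qed.
HB.instance Definition _ r :=
  GRing.isLinear.Build K V V *:%R (eigproj g T r) (proj_linear r).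

Lemma proj_in r v : eig r (proj r v). Proof. exact: eigproj_in. Qed.

Lemma proj_translation r u : D (proj r u) = proj r (D u).
Proof.
have [_ g1 gm] := g_aut.
rewrite /eigproj linearZ linear_sum; congr (_ *: _); apply: eq_bigr => k _.
rewrite linearZ; congr (_ *: _); elim: (nat_of_ord k) => // j IH.
by rewrite !iterS -IH /translation gm g1.
Qed.

(** * The products as Laurent kernels *)

(** The numbers a_r and m_r with kernel e^(a_r x) y^(m_r) of u <> v, u in V^r. *)
Definition dexp r : K := (tdelta nb r + lf)%:R + r%:R / T%:R.
Definition dpole r : nat := (2 * lf + tdelta nb r + tdelta nb (T - r) + 1)%N.

Lemma diamond_homE r u v :
  diamond_hom A T n r u v = kmode A u (expo (dexp r) * bern K ^+ dpole r) v.
Proof. by rewrite /diamond_hom exp_kernelE. Qed.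

Lemma bullet_hom0E u v : bullet_hom A n 0 u v = kmode A u (bullet_kernel K lf) v.
Proof.
rewrite /bullet_hom eqxx -[RHS]/(kmode_kernel A u v (bullet_kernel K lf)) /bullet_kernel.
rewrite linear_sum; apply: eq_bigr => m _; rewrite linearZ/=; congr (_ *: _).
by rewrite exp_kernelE.
Qed.

Lemma bulletE u v : bullet A g T n u v = kmode A (proj 0 u) (bullet_kernel K lf) v.
Proof.
rewrite /bullet /extend_linearly (bigD1 (Ordinal T0))//= big1 => [|r r0].
  by rewrite addr0 bullet_hom0E.
by rewrite /bullet_hom ifF//; apply/negP => /eqP r0'; case/negP: r0; apply/eqP/val_inj.
Qed.

Lemma bullet_linearl v : linear (fun u => bullet A g T n u v).
Proof.
move=> a u w; rewrite !bulletE linearP /=.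
by rewrite -[LHS]/(kmode_flip A (bullet_kernel K lf) v _) linearP.
Qed.

Lemma bullet_linearr u : linear (bullet A g T n u).
Proof. by move=> a v w; rewrite !bulletE linearP. Qed.

(** Substituting - x for x exchanges the kernels attached to V^r and V^(T-r). *)
Lemma dual_index r : (r < T)%N -> let s := ((T - r) %% T)%N in
  dpole s = dpole r /\ dexp s = (dpole r)%:R - dexp r.
Proof.
have [nbT _] := nbarP g_order n_mult.
case: r => [|r] rT /=.
  rewrite subn0 modnn /dexp /dpole subn0 /tdelta leq0n leqNgt nbT /=.
  split=> //; rewrite mul0r addr0 (_ : _ + 1 = (1 + lf) + (1 + lf))%N; last lia.
  by rewrite [in RHS]natrD addrK.
rewrite modn_small; last lia.
rewrite /dexp /dpole subKn 1?ltnW//; split; first lia.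
rewrite natrB 1?ltnW// mul2n -addnn !natrD; field; exact: TK.
Qed.

(** * The subspace divided out *)

Local Notation OO := (lin_spanb (O_gens A g T n)).

Lemma translation_O u : D u \in OO.
Proof.
apply/asboolP; exists 1%N, (fun=> 1), (fun=> D u); split; last first.
  by rewrite big_ord1 scale1r.
by move=> _; right; exists u.
Qed.

Lemma diamond_O u v : diamond A g T n u v \in OO.
Proof.
apply/asboolP; exists 1%N, (fun=> 1), (fun=> diamond A g T n u v); split; last first.
  by rewrite big_ord1 scale1r.
by move=> _; left; exists u, v.
Qed.

Lemma O_ind (P : V -> Prop) :
  (forall a u v, P u -> P v -> P (a *: u + v)) -> P 0 ->
  (forall u v, P (diamond A g T n u v)) -> (forall u, P (D u)) ->
  forall v, v \in OO -> P v.
Proof.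
move=> PD PZ Pd PT v /asboolP[m [c [s [Ss ->]]]].
elim/big_ind: _ => // [x y Px Py|i _]; first by rewrite -[x]scale1r; exact: PD.
by rewrite -[_ *: _]addr0; apply: PD => //; case: (Ss i) => [[u [w ->]]|[u ->]].
Qed.

Lemma diamond_eig r u v : (r < T)%N -> eig r u ->
  diamond A g T n u v = kmode A u (expo (dexp r) * bern K ^+ dpole r) v.
Proof.
move=> rT ur; rewrite /diamond /extend_linearly (bigD1 (Ordinal rT))//= big1.
  by rewrite addr0 (proj_eig rT rT ur) eqxx diamond_homE.
move=> s sr; rewrite (proj_eig (ltn_ord s) rT ur) ifF; last first.
  by apply/negP => /eqP sr'; case/negP: sr; apply/eqP/val_inj.
by rewrite diamond_homE -[LHS]/(kmode_flip A _ v 0) linear0.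
Qed.

(** As D u stays in V^r and the derivative of e^(a x) y^m is
    (a - m) e^(a x) y^m - m e^(a x) y^(m+1), integration by parts passes from the
    pole of order m to that of order m + 1. *)
Lemma kernel_gen_O r u v t : (r < T)%N -> eig r u ->
  kmode A u (expo (dexp r) * bern K ^+ (dpole r + t)) v \in OO.
Proof.
move=> rT; elim: t u => [|t IH] u ur.
  by rewrite addn0 -diamond_eig//; exact: diamond_O.
have m0 : (dpole r + t)%:R != 0 :> K by rewrite pnatr_eq0 /dpole; lia.
have := IH _ (eig_translation ur); rewrite kmode_translation lderiv_kernel_gen.
rewrite -[kmode _ _ _ _]/(kmode_kernel A u v _) linearB/= !linearZ/= rpredN => h.
have := rpredB (rpredZ (dexp r - (dpole r + t)%:R) (IH _ ur)) h.
rewrite /kmode_kernel scalerN opprB addrC subrK => /(rpredZ (dpole r + t)%:R^-1).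
by rewrite scalerA mulVf// scale1r addnS.
Qed.

Lemma kernel_O r u v F : (r < T)%N -> eig r u -> kernel (dexp r) (dpole r) F ->
  kmode A u F v \in OO.
Proof.
move=> rT ur [p ->]; rewrite -[kmode _ _ _ _]/(kmode_kernel A u v _).
rewrite [horner_alg _ p](_ : _ = \sum_(i < size p) p`_i *: bern K ^+ i); last first.
  rewrite -[p in LHS]coefK poly_def linear_sum /=; apply: eq_bigr => i _.
  by rewrite linearZ/= rmorphXn/= horner_algX mulr_algl.
rewrite mulr_sumr linear_sum rpred_sum// => i _.
rewrite -scalerAr linearZ/= rpredZ// -mulrA -exprD; exact: kernel_gen_O.
Qed.

(** Up to an element of the image of D, v <> 1 is the residue of e^(a x) y^m
    times v, and this residue can vanish only for integral a, whereas a_s is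
    congruent to s / T modulo the integers. *)
Lemma eig_O s v : (0 < s < T)%N -> eig s v -> v \in OO.
Proof.
move=> /andP[s0 sT] vs.
have := kernel_O (vacuum A) sT vs (kernel_gen _ _).
have [w ->] := kmode_vacuum A v (expo (dexp s) * bern K ^+ dpole s).
set c := lcoef _ _ => h.
have c0 : c != 0.
  rewrite /c /dpole addn1; apply: residue_kernel_neq0 => j _.
  apply/eqP => /(congr1 ( *%R^~ T%:R)); rewrite /dexp mulrDl divfK//.
  rewrite -!natrM -natrD => /eqP; rewrite eqr_nat => /eqP /(congr1 (modn^~ T)).
  by rewrite modnMDl modnMl modn_small//; lia.
have := rpredZ c^-1 (rpredB h (translation_O w)).
by rewrite addrK scalerA mulVf// scale1r.
Qed.

Lemma proj0_O v : v - proj 0 v \in OO.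
Proof.
rewrite -{1}(eigproj_sum g_order v) (bigD1 (Ordinal T0))//= addrAC subrr add0r.
apply: rpred_sum => s s0; apply: (@eig_O s); last exact: proj_in.
rewrite ltn_ord andbT lt0n; apply/negP => /eqP h; case/negP: s0.
exact/eqP/val_inj.
Qed.

(** P is regular at z = 0 and at z = oo. *)
Lemma kernel_mul_bullet a m F :
  kernel a m F -> kernel a m (F * bullet_kernel K lf).
Proof.
move=> kF; apply: (kernel_shift (s := lf.+1) (t := lf.+1)) => //.
exact: kernelM kF (bullet_kernel_kernel _ _).
Qed.

Lemma dexp0 : dexp 0 = lf.+1%:R.
Proof. by rewrite /dexp mul0r addr0. Qed.

Lemma dpole0 : dpole 0 = (2 * lf + 2)%N.
Proof.
have [nbT _] := nbarP g_order n_mult.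
by rewrite /dpole subn0 /tdelta leq0n leqNgt nbT /=; lia.
Qed.

(** * Well-definedness *)

(** The modes of u in V^r shift the grading by r. *)
Lemma proj0_kmode r u F w : (r < T)%N -> eig r u ->
  proj 0 (kmode A u F w) = kmode A u F (proj ((T - r) %% T) w).
Proof.
move=> rT ur; have sT : ((T - r) %% T < T)%N by rewrite ltn_mod.
rewrite -{1}(eigproj_sum g_order w) (linear_sum (kmode A u F)) linear_sum.
rewrite (bigD1 (Ordinal sT))//= big1.
  rewrite addr0 (@proj_eig _ ((r + (T - r) %% T) %% T)) ?ltn_mod//; last first.
    exact: eig_kmode (proj_in _ _).
  by rewrite modnDmr subnKC 1?ltnW// modnn.
move=> t ts; rewrite (@proj_eig _ ((r + t) %% T)) ?ltn_mod//; last first.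
  exact: eig_kmode (proj_in _ _).
case: eqP => // h; case/negP: ts; apply/eqP/val_inj => /=.
have tT := ltn_ord t; have [rt|rt] := ltnP (r + t) T.
  rewrite modn_small// in h; have [-> ->] : r = 0%N /\ nat_of_ord t = 0%N by lia.
  by rewrite subn0 modnn.
have : ((r + t) = (r + t - T) + T)%N by lia.
move=> e; move: h; rewrite e modnDr modn_small; last lia.
by move=> h; rewrite modn_small; lia.
Qed.

(** For the generators u <> w apply [kmode_assoc] to the kernel F of u <> w and to
    P: the derivatives of F stay in the space of r, and their reflections, times
    P, in the space of T - r, to which the component of w that contributes
    belongs. *)
Lemma bullet_Ol u v : u \in OO -> bullet A g T n u v \in OO.
Proof.
move: u; apply: O_ind => [a u w uO wO|||].
- by rewrite bullet_linearl rpredD// rpredZ.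
- by rewrite bulletE linear0 -[kmode _ _ _ _]/(kmode_flip A _ v 0) linear0 rpred0.
- move=> u w; rewrite bulletE /diamond /extend_linearly linear_sum /=.
  rewrite -[kmode _ _ _ _]/(kmode_flip A _ v _) linear_sum /= rpred_sum// => -[r rT] _ /=.
  rewrite /kmode_flip diamond_homE (proj0_kmode _ _ rT (proj_in _ _)).
  set F := expo _ * _; set s := ((T - r) %% T)%N; set u' := proj r u.
  have sT : (s < T)%N by rewrite ltn_mod.
  have kF i : kernel (dexp r) (dpole r) (hasse i F) by exact/kernel_hasse/kernel_gen.
  have [I [y [z ->]]] := kmode_assoc A u' (proj s w) v F (bullet_kernel K lf).
  apply: rpredD; [apply: rpredD|].
  + by apply: (kernel_O _ rT (proj_in _ _)); rewrite -[F]hasse0.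
  + by apply: rpred_sum => i _; exact: kernel_O rT (proj_in _ _) (kF _).
  + apply: rpred_sum => i _.
    apply: (kernel_O _ sT (proj_in _ _)); apply: kernel_mul_bullet.
    by have [-> ->] := dual_index rT; exact: kernel_negx.
- move=> u; rewrite bulletE -proj_translation kmode_translation rpredN.
  apply: (kernel_O _ T0 (proj_in _ _)); rewrite dexp0 dpole0.
  exact: lderiv_bullet_kernel.
Qed.

(** For the generators v <> w, commute the mode of u past that of v: the remaining
    terms are modes of vectors u_i v, which have the degree of v because u may be
    taken in V^0. *)
Lemma bullet_Or u v : v \in OO -> bullet A g T n u v \in OO.
Proof.
move: v; apply: O_ind => [a v w vO wO|||].
- by rewrite bullet_linearr rpredD// rpredZ.
- by rewrite bulletE linear0 rpred0.
- move=> v w; rewrite bulletE /diamond /extend_linearly linear_sum /=.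
  rewrite rpred_sum// => -[r rT] _ /=; rewrite diamond_homE.
  have [I ->] := kmode_comm A (proj 0 u) (proj r v) w (bullet_kernel K lf)
    (expo (dexp r) * bern K ^+ dpole r).
  apply: rpredD; last apply: rpred_sum => i _.
    by apply: (kernel_O _ rT (proj_in _ _)); exact: kernel_gen.
  apply: (kernel_O _ rT); first exact: eig_mode0 (proj_in _ _) (proj_in _ _).
  apply: (kernel_shift (s := lf.+1) (t := lf.+1)) => //.
  rewrite [hasse _ _ * _]mulrC.
  exact: kernelM (kernel_gen _ _) (kernel_hasse _ (bullet_kernel_kernel _ _)).
- move=> v; rewrite bulletE.
  have -> : kmode A (proj 0 u) (bullet_kernel K lf) (D v)
    = D (kmode A (proj 0 u) (bullet_kernel K lf) v)
      - kmode A (D (proj 0 u)) (bullet_kernel K lf) v.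
    by rewrite translation_kmode addrK.
  by rewrite rpredB ?translation_O// proj_translation -bulletE bullet_Ol// translation_O.
Qed.

(** * Associativity and unit *)

(** By [kmode_assoc] with F = G = P the difference consists of terms with kernel
    P^(i), i > 0, or P^(i)(- x) P(x). *)
Lemma bullet_assoc u v w :
  bullet A g T n (bullet A g T n u v) w - bullet A g T n u (bullet A g T n v w) \in OO.
Proof.
rewrite !bulletE (proj0_kmode _ _ T0 (proj_in _ _)) subn0 modnn.
set P := bullet_kernel K lf.
have [I [y [z ->]]] := kmode_assoc A (proj 0 u) (proj 0 v) w P P.
rewrite -[X in X - _]addrA addrAC subrr add0r.
apply: rpredD; apply: rpred_sum => i _.
  apply: (kernel_O _ T0 (proj_in _ _)); rewrite dexp0 dpole0.
  exact/kernel_hasseS/lderiv_bullet_kernel.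
apply: (kernel_O _ T0 (proj_in _ _)); rewrite dexp0 dpole0.
case: (nat_of_ord i) => [|j]; first by rewrite hasse0; exact: bullet_kernel_negx.
apply: kernel_mul_bullet.
have := kernel_negx (kernel_hasseS j (lderiv_bullet_kernel K lf)).
rewrite {1}(_ : 2 * lf + 2 = lf.+1 + lf.+1)%N; last lia.
by rewrite natrD addrK.
Qed.

Lemma bullet1l v : bullet A g T n (vacuum A) v = v.
Proof.
rewrite bulletE (proj_eig T0 T0 eig_vacuum) eqxx.
rewrite /kmode /residue /laurent_mul (@fsbig_box _ (-1) 1).
- by rewrite big_ord1 addr0 residue_bullet_kernel scale1r /vseries vacuum_mode.
- by move=> p p1; rewrite /vseries vacuum_mode ifF ?scaler0//; lia.
- by move=> p p1; rewrite /vseries vacuum_mode ifF ?scaler0//; lia.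
Qed.

Lemma bullet1r u : bullet A g T n u (vacuum A) - u \in OO.
Proof.
rewrite bulletE; have [w ->] := kmode_vacuum A (proj 0 u) (bullet_kernel K lf).
rewrite residue_bullet_kernel scale1r -opprB rpredN opprD addrA.
by rewrite rpredB ?proj0_O// translation_O.
Qed.

End TwistedAlgebra.

Theorem theorem3p4 (R : realType) (V : lmodType R[i]) (A : vertexAlgebra V)
  (g : {linear V -> V}) (T : nat) (n : rat)
  (g_aut : vertex_automorphism A g) (g_order : has_order g T)
  (n_mult : exists N : nat, n = N%:R / T%:R) :
  exists mul : Atilde A g T n -> Atilde A g T n -> Atilde A g T n,
    (forall u v : V, mul (Atilde_pi A g T n u) (Atilde_pi A g T n v)
                     = Atilde_pi A g T n (bullet A g T n u v)) /\
    unital_assoc_algebra mul (Atilde_pi A g T n (vacuum A)).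
Proof.
have surj (x : Atilde A g T n) : exists v, Atilde_pi A g T n v = x.
  exact: span_pi_surj.
have pi_eq u v : u - v \in lin_spanb (O_gens A g T n) ->
    Atilde_pi A g T n u = Atilde_pi A g T n v.
  by move=> /asboolP uv; apply/span_pi_eq.
have eq_pi u v : Atilde_pi A g T n u = Atilde_pi A g T n v ->
    u - v \in lin_spanb (O_gens A g T n).
  by move=> /span_pi_eq uv; apply/asboolP.
have pi_lin : linear (Atilde_pi A g T n) by exact: span_pi_linear.
pose rep x := projT1 (cid (surj x)).
have repK x : Atilde_pi A g T n (rep x) = x by exact: projT2 (cid (surj x)).
pose mul x y := Atilde_pi A g T n (bullet A g T n (rep x) (rep y)).
have mulE u v : mul (Atilde_pi A g T n u) (Atilde_pi A g T n v)
    = Atilde_pi A g T n (bullet A g T n u v).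
  apply: pi_eq; set x := rep _; set y := rep _.
  have xu : x - u \in lin_spanb (O_gens A g T n) by exact/eq_pi/repK.
  have yv : y - v \in lin_spanb (O_gens A g T n) by exact/eq_pi/repK.
  rewrite (_ : _ - _ = bullet A g T n (x - u) y + bullet A g T n u (y - v)).
    by apply: rpredD; [exact: bullet_Ol|exact: bullet_Or].
  have -> : bullet A g T n (x - u) y = bullet A g T n x y - bullet A g T n u y.
    have := bullet_linearl A n g_order y (-1) u x.
    by rewrite !scaleN1r ![- _ + _]addrC.
  have -> : bullet A g T n u (y - v) = bullet A g T n u y - bullet A g T n u v.
    have := bullet_linearr A n g_order u (-1) v y.
    by rewrite !scaleN1r ![- _ + _]addrC.
  by rewrite addrA subrK.
exists mul; split => //; split.
- move=> y a x z; have [u <-] := surj x; have [v <-] := surj y; have [w <-] := surj z.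
  by rewrite -pi_lin !mulE -pi_lin (bullet_linearl A n g_order).
- move=> x a y z; have [u <-] := surj x; have [v <-] := surj y; have [w <-] := surj z.
  by rewrite -pi_lin !mulE -pi_lin (bullet_linearr A n g_order).
- move=> x y z; have [u <-] := surj x; have [v <-] := surj y; have [w <-] := surj z.
  rewrite !mulE; apply/esym/pi_eq; exact: bullet_assoc.
- by move=> x; have [u <-] := surj x; rewrite mulE bullet1l.
- by move=> x; have [u <-] := surj x; rewrite mulE; apply/pi_eq/bullet1r.
Qed.
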